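(* Let $\mathfrak{h}$ be a complex vector space of finite dimension $d$ with a non-degenerate symmetric bilinear form $(\cdot,\cdot)$, and let $\alpha_1,\dots,\alpha_d$ be an orthonormal basis of $\mathfrak{h}$ with respect to $(\cdot,\cdot)$. Let $\phi$ be the anti-linear involution of the Heisenberg vertex operator algebra $M_{\mathfrak{h}}(1,0)$ determined by $\phi(\alpha_{i_1}(-n_1)\cdots\alpha_{i_k}(-n_k)\mathbf{1})=(-1)^k\alpha_{i_1}(-n_1)\cdots\alpha_{i_k}(-n_k)\mathbf{1}$ for $1\le i_j\le d$, $n_j\ge1$. Then $M_{\mathfrak{h}}(1,0)$, with $\phi$, is a unitary vertex operator algebra. Furthermore, if $\lambda\in\mathfrak{h}$ satisfies $(\alpha_i,\lambda)\ge0$ for $1\le i\le d$, then $M_{\mathfrak{h}}(1,\lambda)$ is a unitary irreducible $M_{\mathfrak{h}}(1,0)$-module (with respect to $\phi$).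
   Context: The Heisenberg algebra is $\hat{\mathfrak{h}}=\mathfrak{h}\otimes\mathbb{C}[t,t^{-1}]\oplus\mathbb{C}K$ with $K$ central and $[\beta(m),\gamma(n)]=m(\beta,\gamma)\delta_{m+n,0}K$, $\beta(n)=\beta\otimes t^n$. For $\lambda\in\mathfrak{h}$, $M_{\mathfrak{h}}(1,\lambda)=U(\hat{\mathfrak{h}})/J_\lambda$, where $J_\lambda$ is the left ideal generated by $\beta(n)$ ($\beta\in\mathfrak{h}$, $n\ge1$), $\beta(0)-(\beta,\lambda)$ ($\beta\in\mathfrak{h}$) and $K-1$. $M_{\mathfrak{h}}(1,0)$ is a vertex operator algebra with vacuum $\mathbf{1}=1+J_0$, $Y(\beta(-1)\mathbf{1},z)=\sum_n\beta(n)z^{-n-1}$ and Virasoro vector $\omega=\frac12\sum_{i=1}^d\alpha_i(-1)^2\mathbf{1}$, and each $M_{\mathfrak{h}}(1,\lambda)$ is an irreducible ordinary $M_{\mathfrak{h}}(1,0)$-module. For a vertex operator algebra $V$ (over $\mathbb{C}$, CFT type: $V=\bigoplus_{n\ge0}V_n$, $V_0=\mathbb{C}\mathbf{1}$) with $Y(a,z)=\sum_na_nz^{-n-1}$, $Y(\omega,z)=\sum_nL(n)z^{-n-2}$, an anti-linear involution is an anti-linear bijection $\phi:V\to V$ of order $2$ with $\phi(\mathbf{1})=\mathbf{1}$, $\phi(\omega)=\omega$, $\phi(u_nv)=\phi(u)_n\phi(v)$. An ordinary $V$-module $(M,Y_M)$ is unitary (with respect to $\phi$) if there is a positive definite Hermitian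 form $(\cdot,\cdot)_M$ on $M$, linear in the first and anti-linear in the second variable, with $(Y_M(e^{zL(1)}(-z^{-2})^{L(0)}a,z^{-1})w_1,w_2)_M=(w_1,Y_M(\phi(a),z)w_2)_M$ for all $a\in V$, $w_1,w_2\in M$ (the formal variable $z$ being treated as real). $(V,\phi)$ is a unitary vertex operator algebra if this holds for $M=V$. *)

(* Defs.v *)
From HB Require Import structures.
From mathcomp Require Import all_boot all_order all_algebra.
From mathcomp Require Import finmap.
From mathcomp Require Import monalg.
From mathcomp Require Import boolp classical_sets functions cardinality fsbigop.
From mathcomp Require Import reals.
From mathcomp Require Import complex.
Set Implicit Arguments.
Unset Strict Implicit.
Unset Printing Implicit Defensive.
Import Order.TTheory GRing.Theory Num.Theory.
Local Open Scope classical_set_scope.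
Local Open Scope ring_scope.
Local Open Scope quotient_scope.

Section LmodQuotient.
Context (K : pzRingType) (V : lmodType K) (S : zmodClosed V).
Context (Sscale : GRing.scaler_closed S).

Definition lquot of GRing.scaler_closed S := Quotient.quot S.
Local Notation Q := (lquot Sscale).

HB.instance Definition _ := GRing.Zmodule.on Q.
HB.instance Definition _ := EqQuotient.on Q.

Definition lquot_scale (c : K) (x : Q) : Q := \pi_Q (c *: repr x).

Lemma pi_lquot_eq (x y : V) : (\pi_Q x = \pi_Q y) <-> (x - y \in S).
Proof. by rewrite (@Quotient.idealrBE V S); split=> /eqP. Qed.

Lemma pi_lquotB : {morph \pi_Q : x y / x - y}.
Proof. exact: (raddfB (\pi_(Quotient.quot S))). Qed.

Lemma pi_lquotD : {morph \pi_Q : x y / x + y}.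
Proof. exact: (raddfD (\pi_(Quotient.quot S))). Qed.

Lemma pi_lquot_scale c x : lquot_scale c (\pi_Q x) = \pi_Q (c *: x).
Proof.
apply/pi_lquot_eq; rewrite -scalerBr Sscale //.
by apply/pi_lquot_eq; rewrite reprK.
Qed.

Let lquot_scaleA a b x : lquot_scale a (lquot_scale b x) = lquot_scale (a * b) x.
Proof. by rewrite -[x]reprK !pi_lquot_scale scalerA reprK. Qed.
Let lquot_scale1 : left_id 1 lquot_scale.
Proof. by move=> x; rewrite -[x]reprK !pi_lquot_scale scale1r. Qed.
Let lquot_scaleDr : right_distributive lquot_scale +%R.
Proof.
move=> a x y; rewrite -[x]reprK -[y]reprK -pi_lquotD !pi_lquot_scale.
by rewrite scalerDr pi_lquotD.
Qed.
Let lquot_scaleDl x : {morph lquot_scale^~ x : a b / a + b}.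
Proof.
by move=> a b; rewrite -[x]reprK !pi_lquot_scale scalerDl pi_lquotD.
Qed.
HB.instance Definition _ := GRing.Zmodule_isLmodule.Build K Q
  lquot_scaleA lquot_scale1 lquot_scaleDr lquot_scaleDl.

Lemma pi_lquot_is_linear : linear \pi_Q.
Proof. by move=> a x y; rewrite pi_lquotD -pi_lquot_scale. Qed.

HB.instance Definition _ :=
  GRing.isLinear.Build K V Q _ (\pi_Q) pi_lquot_is_linear.

End LmodQuotient.

(* For an associative unital algebra, ideals are automatically linear
   subspaces; closure under scalars is therefore harmlessly listed. *)
Section Ideals.
Context (K : pzRingType) (A : lalgType K).

Definition left_ideal (I : set A) : Prop :=
  [/\ I 0, forall (a : K) x y, I x -> I y -> I (a *: x + y) &
      forall u x, I x -> I (u * x)].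

Definition two_sided_ideal (I : set A) : Prop :=
  left_ideal I /\ (forall u x, I x -> I (x * u)).

Definition left_ideal_span (G : set A) : {pred A} :=
  [pred x | `[< smallest left_ideal G x >]].

Definition two_sided_ideal_span (G : set A) : {pred A} :=
  [pred x | `[< smallest two_sided_ideal G x >]].

Lemma smallest_left_ideal (G : set A) : left_ideal (smallest left_ideal G).
Proof.
split=> [I [[]]//|a x y Gx Gy I GI|u x Gx I GI]; case: (GI) => -[I0 IZ IM] _.
  by apply: IZ; [exact: Gx|exact: Gy].
by apply: IM; exact: Gx.
Qed.

Lemma smallest_two_sided_ideal (G : set A) :
  two_sided_ideal (smallest two_sided_ideal G).
Proof.
split; first split=> [I [[[]]]//|a x y Gx Gy I GI|u x Gx I GI];
  last move=> u x Gx I GI; case: (GI) => -[[I0 IZ IM] IMr] _.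
- by apply: IZ; [exact: Gx|exact: Gy].
- by apply: IM; exact: Gx.
- by apply: IMr; exact: Gx.
Qed.

Lemma left_ideal_span_closed G : submod_closed (left_ideal_span G).
Proof.
have [I0 IZ _] := smallest_left_ideal G.
split=> [|a x y /asboolP Ix /asboolP Iy]; apply/asboolP; first exact: I0.
exact: IZ.
Qed.

Lemma two_sided_ideal_span_closed G : submod_closed (two_sided_ideal_span G).
Proof.
have [[I0 IZ _] _] := smallest_two_sided_ideal G.
split=> [|a x y /asboolP Ix /asboolP Iy]; apply/asboolP; first exact: I0.
exact: IZ.
Qed.

HB.instance Definition _ G := GRing.isZmodClosed.Build A
  (left_ideal_span G) (GRing.submod_closedB (left_ideal_span_closed G)).
HB.instance Definition _ G := GRing.isZmodClosed.Build A
  (two_sided_ideal_span G) (GRing.submod_closedB (two_sided_ideal_span_closed G)).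

Lemma left_ideal_spanZ G : GRing.scaler_closed (left_ideal_span G).
Proof. exact: GRing.submod_closed_semi (left_ideal_span_closed G). Qed.

Lemma two_sided_ideal_spanZ G : GRing.scaler_closed (two_sided_ideal_span G).
Proof. exact: GRing.submod_closed_semi (two_sided_ideal_span_closed G). Qed.

Lemma left_ideal_spanM G u x :
  x \in left_ideal_span G -> u * x \in left_ideal_span G.
Proof.
have [_ _ IM] := smallest_left_ideal G.
by move=> /asboolP Ix; apply/asboolP; exact: IM.
Qed.

Lemma two_sided_ideal_spanMl G u x :
  x \in two_sided_ideal_span G -> u * x \in two_sided_ideal_span G.
Proof.
have [[_ _ IM] _] := smallest_two_sided_ideal G.
by move=> /asboolP Ix; apply/asboolP; exact: IM.
Qed.

Lemma two_sided_ideal_spanMr G u x :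
  x \in two_sided_ideal_span G -> x * u \in two_sided_ideal_span G.
Proof.
have [_ IM] := smallest_two_sided_ideal G.
by move=> /asboolP Ix; apply/asboolP; exact: IM.
Qed.

(* The left A-module A / J, for J the left ideal generated by G. *)
Definition left_quot (G : set A) := lquot (@left_ideal_spanZ G).
HB.instance Definition _ G := GRing.Lmodule.on (left_quot G).
HB.instance Definition _ G := EqQuotient.on (left_quot G).

Definition left_act G (u : A) (m : left_quot G) : left_quot G :=
  \pi_(left_quot G) (u * repr m).

Lemma left_act_pi G u x :
  left_act u (\pi_(left_quot G) x) = \pi_(left_quot G) (u * x).
Proof.
apply/pi_lquot_eq; rewrite -mulrBr left_ideal_spanM //.
by apply/(pi_lquot_eq (@left_ideal_spanZ G)); exact: (@reprK _ (left_quot G)).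
Qed.

End Ideals.

Section UniversalEnveloping.
Context (K : comNzRingType) (g : lmodType K) (br : g -> g -> g).

(* The free algebra on the underlying set of g. Modulo the linearity relations
   it is the tensor algebra of g, so adding the bracket relations gives U(g). *)
Local Notation F := {malg K[{fmonom g}]}.

Definition free_gen (x : g) : F := << fmu x >>.
Local Notation gen := free_gen.

Definition uea_relations : set F :=
  [set r | (exists (a : K) (x y : g), r = gen (a *: x + y) - (a *: gen x + gen y))
        \/ (exists x y : g, r = gen x * gen y - gen y * gen x - gen (br x y))].

Definition uea := lquot (@two_sided_ideal_spanZ K F uea_relations).
HB.instance Definition _ := GRing.Lmodule.on uea.
HB.instance Definition _ := EqQuotient.on uea.

Local Notation I := (two_sided_ideal_span uea_relations).

Definition uea_one : uea := \pi_uea 1.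
Definition uea_mul (x y : uea) : uea := \pi_uea (repr x * repr y).

Lemma pi_uea_mul x y : uea_mul (\pi_uea x) (\pi_uea y) = \pi_uea (x * y).
Proof.
apply/pi_lquot_eq.
set x' := repr _; set y' := repr _.
have -> : x' * y' - x * y = (x' - x) * y' + x * (y' - y).
  by rewrite mulrBl mulrBr addrA subrK.
apply: rpredD; [apply: two_sided_ideal_spanMr|apply: two_sided_ideal_spanMl];
  by apply/(pi_lquot_eq (@two_sided_ideal_spanZ K F uea_relations));
     exact: (@reprK _ uea).
Qed.

Let uea_mulA : associative uea_mul.
Proof.
by move=> x y z; rewrite -[x]reprK -[y]reprK -[z]reprK !pi_uea_mul mulrA !reprK.
Qed.
Let uea_mul1 : left_id uea_one uea_mul.
Proof. by move=> x; rewrite -[x]reprK pi_uea_mul mul1r. Qed.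
Let uea_1mul : right_id uea_one uea_mul.
Proof. by move=> x; rewrite -[x]reprK pi_uea_mul mulr1. Qed.
Let uea_mulDl : left_distributive uea_mul +%R.
Proof.
move=> x y z; rewrite -[x]reprK -[y]reprK -[z]reprK -pi_lquotD !pi_uea_mul.
by rewrite mulrDl pi_lquotD.
Qed.
Let uea_mulDr : right_distributive uea_mul +%R.
Proof.
move=> x y z; rewrite -[x]reprK -[y]reprK -[z]reprK -pi_lquotD !pi_uea_mul.
by rewrite mulrDr pi_lquotD.
Qed.

(* The coefficient of the empty word kills the relations. *)
Let uea_one_neq0 : uea_one != 0.
Proof.
pose ker : set F := [set r : F | r@_(mone : {fmonom g}) = 0].
have ker_ideal : two_sided_ideal ker.
  rewrite /ker; split; first split=> [|a r s /= r0 s0|u r /= r0].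
  - by rewrite /= mcoeff0.
  - by rewrite mcoeffD mcoeffZ r0 s0 mulr0 addr0.
  - by rewrite rmorphM /= r0 mulr0.
  - by move=> u r /= r0; rewrite rmorphM /= r0 mul0r.
have gen0 x : (gen x)@_(mone : {fmonom g}) = 0.
  rewrite /free_gen mcoeffU; case: eqP => // /(congr1 (@fmonom_val g)).
  by rewrite fm1 /fmu fmE.
have -> : (0 : uea) = \pi_uea 0 by rewrite linear0.
apply/negP => /eqP /(pi_lquot_eq (@two_sided_ideal_spanZ K F uea_relations)).
rewrite subr0 => /asboolP /(_ ker) /= ker1.
suff : (1 : F)@_(mone : {fmonom g}) = 0 by rewrite mcoeff1 eqxx => /eqP; rewrite oner_eq0.
apply: ker1; split=> // r [[a [x [y ->]]]|[x [y ->]]]; rewrite /ker /=.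
  by rewrite mcoeffB mcoeffD mcoeffZ !gen0 mulr0 addr0 subr0.
by rewrite !mcoeffB !rmorphM /= !gen0 mulr0 !subr0.
Qed.

HB.instance Definition _ := GRing.Zmodule_isNzRing.Build uea
  uea_mulA uea_mul1 uea_1mul uea_mulDl uea_mulDr uea_one_neq0.

Let uea_scaleAl (a : K) (x y : uea) : a *: (x * y) = (a *: x) * y.
Proof.
rewrite -[x]reprK -[y]reprK; set p := repr x; set q := repr y.
have ZE b r : b *: \pi_uea r = \pi_uea (b *: r) by exact: pi_lquot_scale.
have ME r t : \pi_uea r * \pi_uea t = \pi_uea (r * t) by exact: pi_uea_mul.
by rewrite ME !ZE ME scalerAl.
Qed.
HB.instance Definition _ := GRing.Lmodule_isLalgebra.Build K uea uea_scaleAl.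

Definition uea_in (x : g) : uea := \pi_uea (gen x).

End UniversalEnveloping.

Section Heisenberg.
Context (K : fieldType) (h : vectType K) (B : {symmetric h}).

Definition fin_supp : {pred int -> h} :=
  [pred f | `[< finite_set [set n | f n <> 0] >]].

Lemma fin_supp_closed : submod_closed fin_supp.
Proof.
split=> [|a f g /asboolP Ff /asboolP Fg]; apply/asboolP.
  by rewrite (_ : [set _ | _] = set0) // -subset0 => n /=.
apply: (@sub_finite_set _ _ ([set n | f n <> 0] `|` [set n | g n <> 0])).
  move=> n /= fg; have [f0|f0] := pselect (f n = 0); [right|by left].
  move=> g0; apply: fg; rewrite -[LHS]/(a *: f n + g n).
  by rewrite f0 g0 scaler0 addr0.
by rewrite finite_setU.
Qed.

HB.instance Definition _ := GRing.isSubmodClosed.Build K (int -> h) fin_supp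
  (GRing.submod_closed_semi fin_supp_closed).

(* h (x) C[t, t^-1]: the element f stands for the sum of the f n (x) t^n. *)
Record loop := Loop { loop_coef :> int -> h; _ : loop_coef \in fin_supp }.

HB.instance Definition _ := [isSub for loop_coef].
HB.instance Definition _ := [Choice of loop by <:].
HB.instance Definition _ := [SubChoice_isSubLmodule of loop by <:].

Lemma fin_supp_monomial (b : h) (n : int) :
  (fun m => if m == n then b else 0) \in fin_supp.
Proof.
apply/asboolP; apply: (@sub_finite_set _ _ [set n]); last exact: finite_set1.
by move=> m /=; case: eqP.
Qed.

Definition loop_monomial (b : h) (n : int) : loop := Loop (fin_supp_monomial b n).

(* The Heisenberg algebra; the second component is the coefficient of the
   central element. *)
Definition heis := (loop * K^o)%type.
HB.instance Definition _ := GRing.Lmodule.on heis.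

Definition heis_mode (b : h) (n : int) : heis := (loop_monomial b n, 0).
Definition heis_central : heis := (0, 1).

Definition heis_bracket (x y : heis) : heis :=
  (0, \sum_(m \in [set: int]) m%:~R * B (x.1 m) (y.1 (- m))).

Lemma heis_bracketE (b c : h) (m n : int) :
  heis_bracket (heis_mode b m) (heis_mode c n) =
  (m%:~R * B b c * (m + n == 0)%:R) *: heis_central.
Proof.
rewrite /heis_bracket /=; congr pair; first by rewrite scaler0.
rewrite [RHS]mulr1 -(fsbig_widen [set m] setT) //=; last first.
  by move=> k [_ /= /eqP/negPf ->]; rewrite linear0l mulr0.
rewrite fsbig_set1 eqxx eq_sym -subr_eq0 opprK addrC addrC eq_sym.
by case: eqP => _; rewrite ?mulr1 // linear0r !mulr0.
Qed.

Definition heis_uea := uea heis_bracket.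
HB.instance Definition _ := GRing.Lalgebra.on heis_uea.

Definition uea_mode (b : h) (n : int) : heis_uea :=
  uea_in heis_bracket (heis_mode b n).

Definition highest_weight_relations (lambda : h) : set heis_uea :=
  [set x | [\/ exists (b : h) (n : int), (1 <= n) /\ x = uea_mode b n,
               exists b : h, x = uea_mode b 0 - (B b lambda)%:A |
               x = uea_in heis_bracket heis_central - 1]].

(* M_h(1, lambda) = U(heis) / J_lambda *)
Definition heis_module (lambda : h) := left_quot (highest_weight_relations lambda).
HB.instance Definition _ lambda := GRing.Lmodule.on (heis_module lambda).

Definition heis_vec (lambda : h) : heis_module lambda :=
  \pi_(left_quot (highest_weight_relations lambda)) 1.

Definition heis_op (lambda : h) (b : h) (n : int) :
    heis_module lambda -> heis_module lambda :=
  left_act (uea_mode b n).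

End Heisenberg.

Section VertexOperatorAlgebras.
Context (C : numClosedFieldType).

Definition binz (p : int) (i : nat) : C :=
  (\prod_(j < i) (p - j%:Z)%:~R) / (i`!)%:R.

(* A field Y(a, z) = sum_n a_n z^(-n-1) is given by its modes, a_n = Y a n. *)
Section Borcherds.
Context (A M : lmodType C) (Y : A -> int -> A -> A) (YM : A -> int -> M -> M).

(* The Jacobi identity in components. By truncation only finitely many terms
   of either series are non-zero, so the series are compared through their
   sufficiently long partial sums. *)
Definition jacobi_identity : Prop :=
  forall (a b : A) (w : M) (p q r : int),
  exists N0 : nat, forall N : nat, (N0 <= N)%N ->
    \sum_(i < N) binz p i *: YM (Y a (r + i%:Z) b) (p + q - i%:Z) w =
    \sum_(i < N) ((-1) ^+ i * binz r i) *:
      (YM a (p + r - i%:Z) (YM b (q + i%:Z) w) -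
       (-1) ^ r *: YM b (q + r - i%:Z) (YM a (p + i%:Z) w)).

Definition bilinear_modes : Prop :=
  (forall n w, linear (fun a => YM a n w)) /\ (forall a n, linear (YM a n)).

Definition truncated : Prop :=
  forall a w, exists N : int, forall n, N <= n -> YM a n w = 0.

End Borcherds.

Definition finite_dim (M : lmodType C) (P : set M) : Prop :=
  exists (k : nat) (e : 'I_k -> M), forall v, P v ->
    exists c : 'I_k -> C, v = \sum_(i < k) c i *: e i.

(* Vertex operator algebras of CFT type. L(n) = omega_(n+1). Independence of the
   L(0)-eigenspaces is automatic, so the grading by the eigenspaces V_n only
   needs V to be their sum. *)
Record voa (V : lmodType C) := Voa {
  voa_mode : V -> int -> V -> V;
  voa_vac : V;
  voa_omega : V;
  voa_vir := fun n : int => voa_mode voa_omega (n + 1);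
  voa_bilinear : bilinear_modes voa_mode;
  voa_truncated : truncated voa_mode;
  voa_vacuum : forall n b, voa_mode voa_vac n b = if n == -1 then b else 0;
  voa_creation : forall a n, 0 <= n -> voa_mode a n voa_vac = 0;
  voa_creation1 : forall a, voa_mode a (-1) voa_vac = a;
  voa_jacobi : jacobi_identity voa_mode voa_mode;
  voa_virasoro : exists c : C, forall m n v,
    voa_vir m (voa_vir n v) - voa_vir n (voa_vir m v) =
    (m - n)%:~R *: voa_vir (m + n) v +
    (if m + n == 0 then ((m ^+ 3 - m)%:~R / 12%:R * c) *: v else 0);
  voa_derivative : forall a n b,
    voa_mode (voa_vir (-1) a) n b = - (n%:~R *: voa_mode a (n - 1) b);
  voa_graded : forall v, exists (N : nat) (u : nat -> V),
    (forall n, voa_vir 0 (u n) = n%:R *: u n) /\ v = \sum_(n < N) u n;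
  voa_findim : forall n : nat, finite_dim [set v | voa_vir 0 v = n%:R *: v];
  voa_vac_neq0 : voa_vac != 0;
  voa_CFT : forall v, voa_vir 0 v = 0 -> exists c : C, v = c *: voa_vac
}.

Section Modules.
Context (V : lmodType C) (X : voa V).

Record ordinary_module (M : lmodType C) := OrdinaryModule {
  mod_mode : V -> int -> M -> M;
  mod_vir := fun n : int => mod_mode (voa_omega X) (n + 1);
  mod_bilinear : bilinear_modes mod_mode;
  mod_truncated : truncated mod_mode;
  mod_vacuum : forall n w, mod_mode (voa_vac X) n w = if n == -1 then w else 0;
  mod_jacobi : jacobi_identity (voa_mode X) mod_mode;
  mod_graded : forall w, exists (N : nat) (mu : 'I_N -> C) (u : 'I_N -> M),
    (forall n, mod_vir 0 (u n) = mu n *: u n) /\ w = \sum_(n < N) u n;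
  mod_findim : forall mu : C, finite_dim [set w | mod_vir 0 w = mu *: w];
  mod_lower : forall mu : C, exists N : nat, forall n : nat, (N <= n)%N ->
    forall w, mod_vir 0 w = (mu - n%:R) *: w -> w = 0
}.

Definition irreducible_module (M : lmodType C) (W : ordinary_module M) : Prop :=
  (exists w : M, w <> 0) /\
  forall S : set M,
    S 0 -> (forall (c : C) x y, S x -> S y -> S (c *: x + y)) ->
    (forall a n x, S x -> S (mod_mode W a n x)) ->
    S = [set 0] \/ S = setT.

Definition antilinear (M : lmodType C) (f : M -> M) : Prop :=
  forall (c : C) x y, f (c *: x + y) = c^* *: f x + f y.

Record antilinear_involution (phi : V -> V) : Prop := AntilinearInvolution {
  invol_antilinear : antilinear phi;
  invol_order2 : involutive phi /\ ~ (phi =1 id);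
  invol_vac : phi (voa_vac X) = voa_vac X;
  invol_omega : phi (voa_omega X) = voa_omega X;
  invol_mode : forall u n v,
    phi (voa_mode X u n v) = voa_mode X (phi u) n (phi v)
}.

(* For a of weight n,
     e^(zL(1)) (-z^-2)^L(0) a = sum_j (-1)^n / j! z^(j-2n) L(1)^j a,
   where L(1)^j a = 0 for j > n, and Y(b, z^-1) = sum_m b_m z^(m+1).
   Hence the coefficient of z^(-k-1) in Y(e^(zL(1)) (-z^-2)^L(0) a, z^-1) w is
     sum_j (-1)^n / j! (L(1)^j a)_(2n-2-k-j) w. *)
Definition opposite_mode (M : lmodType C) (YM : V -> int -> M -> M)
    (n : nat) (a : V) (k : int) (w : M) : M :=
  \sum_(j < n.+1) ((-1) ^+ n / (j`!)%:R) *: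
    YM (iter j (voa_vir X 1) a) (2 * n%:Z - 2 - k - j%:Z) w.

(* An arbitrary element of V is written as a sum of its homogeneous
   components u n; the identity of formal series is compared coefficientwise
   at z^(-k-1), with z real, i.e. unaffected by conjugation. *)
Definition invariant_form (phi : V -> V) (M : lmodType C)
    (YM : V -> int -> M -> M) (form : M -> M -> C) : Prop :=
  forall (N : nat) (u : nat -> V), (forall n, voa_vir X 0 (u n) = n%:R *: u n) ->
  forall (k : int) (w1 w2 : M),
    form (\sum_(n < N) opposite_mode YM n (u n) k w1) w2 =
    form w1 (YM (phi (\sum_(n < N) u n)) k w2).

Definition unitary_wrt (phi : V -> V) (M : lmodType C)
    (YM : V -> int -> M -> M) : Prop :=
  exists form : {dot M for (@Num.conj C)}, invariant_form phi YM form.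

Definition unitary_module phi (M : lmodType C) (W : ordinary_module M) : Prop :=
  unitary_wrt phi (mod_mode W).

Definition unitary_voa (phi : V -> V) : Prop :=
  antilinear_involution phi /\ unitary_wrt phi (voa_mode X).

End Modules.
End VertexOperatorAlgebras.

Section HeisenbergVOA.
Context (C : numClosedFieldType) (h : vectType C) (B : {symmetric h}).
Context (d : nat) (alpha : d.-tuple h).

Local Notation M := (heis_module B).
Local Notation V := (M 0).

(* b(-1) 1 *)
Definition heis_state (b : h) : V := heis_op b (-1) (heis_vec B 0).

Record heisenberg_voa (X : voa V) : Prop := {
  heis_voa_vac : voa_vac X = heis_vec B 0;
  heis_voa_omega : voa_omega X =
    2^-1 *: \sum_(i < d) heis_op (tnth alpha i) (-1) (heis_state (tnth alpha i));
  heis_voa_mode : forall b n v, voa_mode X (heis_state b) n v = heis_op b n v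
}.

(* alpha_(i_1)(-n_1) ... alpha_(i_k)(-n_k) 1 for s = [:: (i_1, n_1); ...; (i_k, n_k)] *)
Definition heis_monomial (s : seq ('I_d * nat)) : V :=
  foldr (fun p v => heis_op (tnth alpha p.1) (- p.2%:Z) v) (heis_vec B 0) s.

End HeisenbergVOA.

(* Main.v *)
(* Identify M(1,lambda) with the Fock space of polynomials in x_(i,n), on which
   alpha_i(-n) is multiplication by x_(i,n), alpha_i(n) is n d/dx_(i,n) and
   alpha_i(0) is the scalar (alpha_i, lambda). Monomials are orthogonal for the form
   with (x^k, x^k) = prod k_(i,n)! n^(k_(i,n)), and alpha_i(n) is then adjoint to
   alpha_i(-n) for all n, the case n = 0 because (alpha_i, lambda) is real.

   Invariance of the form under Y(a, z) is proved for monomials a by induction.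
   With T_j = L(1)^j / j! one has T_j (alpha_r b) = sum_s C(-r, s) alpha_(r+s) T_(j-s) b,
   so the opposite modes of alpha_r b are combinations of the left-hand sides of the
   Jacobi identities with p = -r; the right-hand sides involve only the adjoints of
   alpha_i and the opposite modes of b. Comparing with the Jacobi identity with p = 0
   for phi(alpha_r b) = - alpha_r phi(b) completes the induction step.

   Irreducibility: a non-zero vector of minimal degree in a submodule is killed by all
   alpha_i(n), n > 0, hence is a multiple of the vacuum. *)
Require Import Defs.
From HB Require Import structures.
From mathcomp Require Import all_boot all_order all_algebra.
From mathcomp Require Import finmap.
From mathcomp Require Import monalg.
From mathcomp Require Import boolp classical_sets functions cardinality fsbigop.
From mathcomp Require Import reals complex ring zify.
Set Implicit Arguments.
Unset Strict Implicit.
Unset Printing Implicit Defensive.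
Import Order.TTheory GRing.Theory Num.Theory.
Local Open Scope ring_scope.
Local Open Scope quotient_scope.

(** [M(1, lambda)] is a quotient by a generated ideal, so nothing shows at once that it is non-zero
    or that the creation monomials are independent. Fock space settles this: a map out of the
    quotient exists as soon as the relations hold in the target, and the coefficients of polynomials
    become functionals on the module.

    The sign in [phi] is forced by the form. The vector [alpha_i(-1) 1] has weight 1 and is killed
    by [L(1)], so its opposite mode at index [k] is [-alpha_i(-k)], while the form makes
    [alpha_i(-k)] adjoint to [alpha_i(k)]; hence [phi] must negate each [alpha_i].

    Two obstacles shape the unitarity proof. The opposite mode depends on the weight of its
    argument, so an eigenvector of [L(0)] has to be split into monomials of that same weight. Beyond
    the modes of [alpha_i(-1) 1], the vertex operators are reached only through the Jacobi identity,
    which is known for partial sums whose length depends on the vectors; so everything is compared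
    over finite sums with a bound uniform in the finitely many [T_t u] that occur. *)

Section LinearFunctions.
Context (R : pzRingType) (U : lmodType R) (L : lmodType R) (f : U -> L).
Hypothesis f_linear : linear f.

Lemma linearB_of : {morph f : x y / x - y}.
Proof. exact: zmod_morphism_linear. Qed.

Lemma linear0_of : f 0 = 0.
Proof. by rewrite -[0](subrr 0) linearB_of subrr. Qed.

Lemma linearN_of : {morph f : x / - x}.
Proof. by move=> x; rewrite -sub0r linearB_of linear0_of sub0r. Qed.

Lemma linearD_of : {morph f : x y / x + y}.
Proof. by move=> x y; have := f_linear 1 x y; rewrite !scale1r. Qed.

Lemma linearZ_of a : {morph f : x / a *: x}.
Proof. by move=> x; have := f_linear a x 0; rewrite linear0_of !addr0. Qed.

Lemma linear_sum_of (I : Type) (r : seq I) (P : pred I) (F : I -> U) :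
  f (\sum_(i <- r | P i) F i) = \sum_(i <- r | P i) f (F i).
Proof. exact: (big_morph f linearD_of linear0_of). Qed.

End LinearFunctions.

Section LinearCombinators.
Context (K : comPzRingType).

Lemma linear_comp_of (U V W : lmodType K) (f : V -> W) (g : U -> V) :
  linear f -> linear g -> linear (fun x => f (g x)).
Proof. by move=> fL gL a x y; rewrite gL fL. Qed.

Lemma linear_scale_of (U V : lmodType K) (f : U -> V) a :
  linear f -> linear (fun x => a *: f x).
Proof. by move=> fL b x y; rewrite fL scalerDr !scalerA mulrC. Qed.

Lemma linear_add_of (U V : lmodType K) (f g : U -> V) :
  linear f -> linear g -> linear (fun x => f x + g x).
Proof. by move=> fL gL b x y; rewrite fL gL scalerDr addrACA. Qed.

Lemma linear_scaler_of (U : lmodType K) a : linear (fun x : U => a *: x).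
Proof. exact: (@linear_scale_of U U id a). Qed.

Lemma linear_bigsum_of (U V : lmodType K) (I : Type) (r : seq I) (f : I -> U -> V) :
  (forall i, linear (f i)) -> linear (fun x => \sum_(i <- r) f i x).
Proof.
move=> fL a x y; rewrite scaler_sumr -big_split /=.
by apply: eq_bigr => i _; rewrite fL.
Qed.

End LinearCombinators.

(** * Linear maps on monoid algebras *)

Section LinearExtension.
Context (I : choiceType) (R : nzRingType).

Lemma malg_sumU (p : {malg R[I]}) : p = \sum_(k <- msupp p) p@_k *: << k >>.
Proof.
rewrite {1}[p]monalgE; apply: eq_bigr => k _.
by apply/malgP => l; rewrite mcoeffZ !mcoeffU mulr_natr.
Qed.

Lemma malg_ind (P : {malg R[I]} -> Prop) :
    P 0 -> (forall a p q, P p -> P q -> P (a *: p + q)) ->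
    (forall k, P << k >>) -> forall p, P p.
Proof.
move=> P0 PZ PU p; rewrite [p]malg_sumU.
by elim: (enum_fset _) => [|k s IH]; rewrite ?big_nil ?big_cons //; apply: PZ.
Qed.

Context (L : lmodType R) (h : I -> L).

Definition malg_lift (p : {malg R[I]}) : L := \sum_(k <- msupp p) p@_k *: h k.

Lemma malg_liftEw (d : {fset I}) p : (msupp p `<=` d)%fset ->
  malg_lift p = \sum_(k <- d) p@_k *: h k.
Proof.
move=> le_pd; rewrite /malg_lift (big_fset_incl _ le_pd) //= => k _ kNp.
by rewrite mcoeff_outdom // scale0r.
Qed.

Lemma malg_lift_is_linear : linear malg_lift.
Proof.
move=> a p q; pose d := (msupp (a *: p + q) `|` (msupp p `|` msupp q))%fset.
have sub1 : (msupp (a *: p + q) `<=` d)%fset by rewrite fsubsetUl.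
have sub2 : (msupp p `<=` d)%fset by rewrite /d fsetUCA fsubsetUl.
have sub3 : (msupp q `<=` d)%fset by rewrite /d fsetUA fsubsetUr.
rewrite (malg_liftEw sub1) (malg_liftEw sub2) (malg_liftEw sub3).
rewrite scaler_sumr -big_split /=; apply: eq_bigr => k _.
by rewrite mcoeffD mcoeffZ scalerDl scalerA.
Qed.

HB.instance Definition _ :=
  GRing.isLinear.Build R {malg R[I]} L _ malg_lift malg_lift_is_linear.

Lemma malg_liftU k : malg_lift << k >> = h k.
Proof.
by rewrite (malg_liftEw msuppU_le) big_seq_fset1 mcoeffUU scale1r.
Qed.

End LinearExtension.

Lemma malg_linear_ext (I : choiceType) (R : nzRingType) (L : lmodType R)
    (f g : {malg R[I]} -> L) : linear f -> linear g ->
  (forall k, f << k >> = g << k >>) -> f =1 g.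
Proof.
move=> fL gL fg; apply: malg_ind => // [|a p q fp fq]; last by rewrite fL gL fp fq.
by rewrite !linear0_of.
Qed.

Section MonomialProducts.
Context (I : monomType) (R : comNzRingType).
Local Notation F := {malg R[I]}.

Lemma malgUM (k l : I) : << k >> * << l >> = << mmul k l >> :> F.
Proof. by rewrite malgM_def fgmulUU mul1r. Qed.

(** Monomials need not commute with each other, but constants are central because the coefficient
    ring is commutative. *)
Lemma malgU_scaler (k : I) a (p : F) : << k >> * (a *: p) = a *: (<< k >> * p).
Proof.
have comm : << k >> * a%:MP = a%:MP * << k >> :> F.
  by rewrite !malgM_def !fgmulUU mulm1 mul1m mulrC.
by rewrite -[a *: p]mul_malgC mulrA comm -mulrA mul_malgC.
Qed.

Lemma malg_scaler (p q : F) a : p * (a *: q) = a *: (p * q).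
Proof.
move: p; apply: malg_linear_ext => [b p p'|b p p'|m].
- by rewrite mulrDl -scalerAl.
- by rewrite mulrDl -scalerAl scalerDr !scalerA mulrC.
- exact: malgU_scaler.
Qed.

End MonomialProducts.

(** * The universal enveloping algebra and its representations *)

Section EnvelopingAction.
Context (K : comNzRingType) (g : lmodType K) (br : g -> g -> g).

Definition uea_pi (p : {malg K[{fmonom g}]}) : uea br := \pi_(uea br) p.

Lemma uea_piP u : exists p, u = uea_pi p.
Proof. by exists (repr u); rewrite /uea_pi reprK. Qed.

Lemma uea_pi_is_linear : linear uea_pi.
Proof. exact: pi_lquot_is_linear. Qed.

HB.instance Definition _ :=
  GRing.isLinear.Build K {malg K[{fmonom g}]} (uea br) _ uea_pi uea_pi_is_linear.

Lemma uea_inE x : uea_in br x = uea_pi (free_gen x).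
Proof. by []. Qed.

Lemma uea_piM p q : uea_pi (p * q) = uea_pi p * uea_pi q.
Proof. by rewrite /uea_pi -pi_uea_mul. Qed.

Lemma uea_pi1 : uea_pi 1 = 1.
Proof. by []. Qed.

Lemma uea_pi_rel p : uea_relations br p -> uea_pi p = 0.
Proof.
move=> rp; rewrite -[RHS](linear0 uea_pi).
by apply/pi_lquot_eq; rewrite subr0; apply/asboolP => I [_]; exact.
Qed.

Lemma uea_in_is_linear : linear (uea_in br).
Proof.
move=> a x y; apply/eqP; rewrite -subr_eq0 !uea_inE -linearP -linearB.
by apply/eqP/uea_pi_rel; left; exists a, x, y.
Qed.

HB.instance Definition _ :=
  GRing.isLinear.Build K g (uea br) _ (uea_in br) uea_in_is_linear.

Lemma uea_in_commutator x y :
  uea_in br x * uea_in br y - uea_in br y * uea_in br x = uea_in br (br x y).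
Proof.
apply/eqP; rewrite -subr_eq0 !uea_inE -!uea_piM -!linearB.
by apply/eqP/uea_pi_rel; right; exists x, y.
Qed.

Lemma uea_scaler (u v : uea br) a : u * (a *: v) = a *: (u * v).
Proof.
have [[p ->] [q ->]] := (uea_piP u, uea_piP v).
have piZ r : a *: uea_pi r = uea_pi (a *: r) by rewrite linearZ.
by rewrite -uea_piM !piZ -uea_piM malg_scaler.
Qed.

Lemma malgU_fmonom (m : {fmonom g}) :
  << m >> = \prod_(x <- (m : seq g)) free_gen x :> {malg K[{fmonom g}]}.
Proof.
case: m => s /=; elim: s => [|x s IH]; first by rewrite big_nil -fmoneE.
have -> : FMonom (x :: s) = mmul (fmu x) (FMonom s).
  by apply/eqP; rewrite fmP fmM fmU.
by rewrite big_cons -IH -malgUM.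
Qed.

Lemma uea_ind (P : uea br -> Prop) :
    P 1 -> (forall a u v, P u -> P v -> P (a *: u + v)) ->
    (forall x u, P u -> P (uea_in br x * u)) -> forall u, P u.
Proof.
move=> P1 PZ PM u; have [p ->] := uea_piP u.
have P0 : P 0 by have := PZ (-1) 1 1 P1 P1; rewrite scaleN1r addNr.
elim/malg_ind: p => [|a p q Pp Pq|m]; first by rewrite linear0.
  by rewrite linearP; apply: PZ.
rewrite malgU_fmonom; elim: (fmonom_val m) => [|x s IH].
  by rewrite big_nil; exact: P1.
by rewrite big_cons uea_piM; apply: PM.
Qed.

Context (F : lmodType K) (rho : g -> F -> F).

Definition free_act (p : {malg K[{fmonom g}]}) (f : F) : F :=
  malg_lift (fun m : {fmonom g} => foldr rho f m) p.

(** The action goes through a chosen representative; [uea_act_pi] removes the choice once [rho] is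
    bilinear and respects brackets. *)
Definition uea_act (u : uea br) (f : F) : F := free_act (repr u) f.

Hypothesis rho_linearl : forall f, linear (rho^~ f).
Hypothesis rho_linearr : forall x, linear (rho x).
Hypothesis rho_bracket :
  forall x y f, rho x (rho y f) - rho y (rho x f) = rho (br x y) f.

Lemma free_act_linearl f : linear (free_act^~ f).
Proof. by move=> a p q; rewrite /free_act linearP. Qed.

Lemma free_act_linearr p : linear (free_act p).
Proof.
move=> a f f'; rewrite /free_act /malg_lift scaler_sumr -big_split /=.
apply: eq_bigr => m _; rewrite scalerA mulrC -scalerA -scalerDr; congr (_ *: _).
by elim: (fmonom_val m) => //= x s ->; rewrite rho_linearr.
Qed.

Lemma free_actM p q f : free_act (p * q) f = free_act p (free_act q f).
Proof.
move: p; apply: malg_linear_ext => [a p p'|a p p'|m].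
- by rewrite mulrDl -scalerAl free_act_linearl.
- by rewrite free_act_linearl.
move: q; apply: malg_linear_ext => [a q q'|a q q'|m'].
- by rewrite mulrDr malgU_scaler free_act_linearl.
- by rewrite !free_act_linearl free_act_linearr.
by rewrite malgUM /free_act !malg_liftU fmM foldr_cat.
Qed.

Lemma uea_act_pi p f : uea_act (uea_pi p) f = free_act p f.
Proof.
(* The elements of the free algebra that act as zero on all of [F] form a two-sided ideal; it
   contains the relations, hence the ideal that they span. *)
pose I : set {malg K[{fmonom g}]} := [set q | forall v, free_act q v = 0]%classic.
have I0 a q q' : I q -> I q' -> I (a *: q + q').
  by move=> Iq Iq' v; rewrite free_act_linearl Iq Iq' scaler0 addr0.
have actr0 q : free_act q 0 = 0 by exact: linear0_of (free_act_linearr q).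
have actB q q' v : free_act (q - q') v = free_act q v - free_act q' v.
  exact: linearB_of (free_act_linearl v) _ _.
have gen_act x v : free_act (free_gen x) v = rho x v.
  by rewrite /free_act malg_liftU fmU.
have genM x y v : free_act (free_gen x * free_gen y) v = rho x (rho y v).
  by rewrite free_actM !gen_act.
have I_ideal : two_sided_ideal I.
  split; first split=> //; first by move=> v; rewrite /free_act linear0.
    by move=> q q' Iq' v; rewrite free_actM Iq' actr0.
  by move=> q q' Iq' v; rewrite free_actM Iq'.
have I_rel : (uea_relations br `<=` I)%classic.
  move=> _ [[a [x [y ->]]]|[x [y ->]]] v.
    by rewrite actB free_act_linearl !gen_act rho_linearl subrr.
  rewrite (actB _ (free_gen (br x y))) (actB (free_gen x * _)).
  apply/eqP; rewrite subr_eq0 gen_act -rho_bracket; apply/eqP.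
  by congr (_ - _); exact: genM.
have : repr (uea_pi p) - p \in two_sided_ideal_span (uea_relations br).
  apply/(pi_lquot_eq (@two_sided_ideal_spanZ K _ (uea_relations br))).
  exact: (@reprK _ (uea br)).
move=> /asboolP /(_ I (conj I_ideal I_rel)) /(_ f) /eqP.
by rewrite actB subr_eq0 => /eqP.
Qed.

Lemma uea_act_in x f : uea_act (uea_in br x) f = rho x f.
Proof. by rewrite uea_act_pi /free_act malg_liftU fmU. Qed.

Lemma uea_act1 f : uea_act 1 f = f.
Proof.
rewrite -uea_pi1 uea_act_pi /free_act -[1]/(<< mone >>) malg_liftU.
by rewrite fm1.
Qed.

Lemma uea_actM u v f : uea_act (u * v) f = uea_act u (uea_act v f).
Proof.
have [[p ->] [q ->]] := (uea_piP u, uea_piP v).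
by rewrite -uea_piM !uea_act_pi free_actM.
Qed.

Lemma uea_act_linearl f : linear (uea_act^~ f).
Proof.
move=> a u v; have [[p ->] [q ->]] := (uea_piP u, uea_piP v).
by rewrite -linearP !uea_act_pi free_act_linearl.
Qed.

Lemma uea_act_linearr u : linear (uea_act u).
Proof. by move=> a f f'; exact: free_act_linearr. Qed.

End EnvelopingAction.

(** * Quotients by left ideals *)

Section LeftQuotient.
Context (K : pzRingType) (A : lalgType K) (G : set A).
Local Notation M := (left_quot G).

Definition left_pi (u : A) : M := \pi_M u.

Lemma left_piP (m : M) : exists u, m = left_pi u.
Proof. by exists (repr m); rewrite /left_pi reprK. Qed.

Lemma left_pi_is_linear : linear left_pi.
Proof. exact: pi_lquot_is_linear. Qed.

HB.instance Definition _ := GRing.isLinear.Build K A M _ left_pi left_pi_is_linear.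

Lemma left_actE u v : left_act u (left_pi v) = left_pi (u * v).
Proof. exact: left_act_pi. Qed.

Lemma left_actM u v (m : M) : left_act (u * v) m = left_act u (left_act v m).
Proof. by have [w ->] := left_piP m; rewrite !left_actE mulrA. Qed.

Lemma left_act1 (m : M) : left_act 1 m = m.
Proof. by have [w ->] := left_piP m; rewrite left_actE mul1r. Qed.

Lemma left_act_linearl (m : M) : linear (fun u => left_act u m).
Proof.
move=> a u v; have [w ->] := left_piP m.
by rewrite !left_actE mulrDl -scalerAl linearP.
Qed.

Lemma left_act_linearr u : (forall a v, u * (a *: v) = a *: (u * v)) ->
  linear (@left_act K A G u).
Proof.
move=> uZ a x y; have [[v ->] [w ->]] := (left_piP x, left_piP y).
by rewrite -linearP !left_actE mulrDr uZ linearP.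
Qed.

Lemma left_act_rel u : G u -> left_act u (left_pi 1) = 0.
Proof.
move=> Gu; rewrite left_actE mulr1 -[RHS](linear0 left_pi).
by apply/pi_lquot_eq; rewrite subr0; apply/asboolP => I [_]; exact.
Qed.

Context (F : lmodType K) (act : A -> F -> F) (v0 : F).

Definition left_quot_lift (m : M) : F := act (repr m) v0.

Hypothesis act_linearl : forall f, linear (act^~ f).
Hypothesis act_linearr : forall u, linear (act u).
Hypothesis actM : forall u v f, act (u * v) f = act u (act v f).
Hypothesis act_rel : forall u, G u -> act u v0 = 0.

(** The annihilator of [v0] is a left ideal containing [G], so [act u v0] depends only on the class
    of [u]. *)
Lemma left_quot_liftE u : left_quot_lift (left_pi u) = act u v0.
Proof.
pose I : set A := [set x | act x v0 = 0]%classic.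
have act0 x : act x 0 = 0 by exact: linear0_of (act_linearr x).
have I_ideal : left_ideal I.
  split=> /=; rewrite /I /=.
  - exact: linear0_of (act_linearl v0).
  - by move=> a x y x0 y0; rewrite act_linearl x0 y0 scaler0 addr0.
  - by move=> x y y0; rewrite actM y0 act0.
have : repr (left_pi u) - u \in left_ideal_span G.
  apply/(pi_lquot_eq (@left_ideal_spanZ K A G)).
  exact: (@reprK _ M).
move=> /asboolP /(_ I (conj I_ideal act_rel)) /= /eqP.
by rewrite (linearB_of (act_linearl v0)) subr_eq0 => /eqP.
Qed.

Lemma left_quot_lift_linear : linear left_quot_lift.
Proof.
move=> a x y; have [[v ->] [w ->]] := (left_piP x, left_piP y).
by rewrite -linearP !left_quot_liftE act_linearl.
Qed.

Lemma left_quot_lift_act u m :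
  left_quot_lift (left_act u m) = act u (left_quot_lift m).
Proof. by have [v ->] := left_piP m; rewrite left_actE !left_quot_liftE actM. Qed.

End LeftQuotient.

(** * The Heisenberg algebra and its highest weight modules *)

Section HeisenbergAlgebra.
Context (K : fieldType) (h : vectType K) (B : {symmetric h}).

Lemma loop_coefP a (l l' : loop h) n : loop_coef (a *: l + l') n = a *: l n + l' n.
Proof. by []. Qed.

Lemma loop_coef0 n : @loop_coef K h 0 n = 0.
Proof. by []. Qed.

Lemma loop_finite (l : loop h) : finite_set [set n | l n <> 0]%classic.
Proof. by case: l => l /= /asboolP. Qed.

Lemma loopP (l l' : loop h) : (forall n, l n = l' n) -> l = l'.
Proof. by move=> ll'; apply/val_inj/funext. Qed.

Section LoopSum.
Context (L : lmodType K) (G : int -> h -> L).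

(** A map out of [h (x) C[t, t^-1]], given by [G n] on the coefficient of [t^n] and linear as soon
    as every [G n] is. Both the bracket and the Fock representation have this form. *)
Definition loop_sum (l : loop h) : L := \sum_(n \in [set: int]) G n (l n).

Hypothesis G_linear : forall n, linear (G n).

Lemma loop_sumEw (A : {fset int}) (l : loop h) :
  (forall n, n \notin A -> l n = 0) -> loop_sum l = \sum_(n <- A) G n (l n).
Proof.
move=> lA; apply: fsbigTE => n nA; rewrite lA //; exact: linear0_of (G_linear n).
Qed.

Lemma loop_sum_is_linear : linear loop_sum.
Proof.
move=> a l l'.
(* The three sums have different supports and are compared over a common finite set. *)
pose A := (fset_set [set n | l n <> 0]%classic `|` fset_set [set n | l' n <> 0]%classic)%fset.
have out n : n \notin A -> l n = 0 /\ l' n = 0.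
  rewrite inE negb_or !in_fset_set; [|exact: loop_finite..].
  by move=> /andP[]; rewrite !notin_setE => /contrapT-> /contrapT->.
have outl n : n \notin A -> l n = 0 by move=> /out[].
have outl' n : n \notin A -> l' n = 0 by move=> /out[].
have outs n : n \notin A -> loop_coef (a *: l + l') n = 0.
  by move=> /out[ln l'n]; rewrite loop_coefP ln l'n scaler0 addr0.
rewrite (loop_sumEw outl) (loop_sumEw outl') (loop_sumEw outs).
rewrite scaler_sumr -big_split; apply: eq_bigr => n _.
by rewrite loop_coefP G_linear.
Qed.

Lemma loop_sum_monomial b n : loop_sum (loop_monomial b n) = G n b.
Proof.
rewrite (@loop_sumEw [fset n]%fset) ?big_seq_fset1 /= ?eqxx // => m.
by rewrite inE => /negPf /= ->.
Qed.

End LoopSum.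

Lemma loop_monomial_is_linear n : linear (fun b : h => loop_monomial b n).
Proof.
move=> a b c; apply: loopP => m; rewrite loop_coefP /=.
by case: (m == n); rewrite // scaler0 addr0.
Qed.

Lemma loop_sumE (l : loop h) :
  l = \sum_(n <- fset_set [set n | l n <> 0]%classic) loop_monomial (l n) n.
Proof.
apply: loopP => m.
have coefD : {morph (fun k : loop h => k m) : x y / x + y} by [].
rewrite (big_morph _ coefD (loop_coef0 m)) /=.
set S := fset_set _; have [mS|mS] := boolP (m \in S).
  rewrite (big_fsetD1 m) //= eqxx big1_fset ?addr0 // => n.
  by rewrite !inE eq_sym => /andP[/negPf-> _] _.
rewrite big1_fset => [|n nS _]; last by case: eqP => // mn; rewrite mn nS in mS.
move: mS; rewrite in_fset_set; last exact: loop_finite.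
by rewrite notin_setE => /contrapT.
Qed.

Lemma heis_ind (P : heis h -> Prop) :
    (forall a x y, P x -> P y -> P (a *: x + y)) ->
    (forall b n, P (heis_mode b n)) -> P (heis_central h) -> forall x, P x.
Proof.
move=> PZ Pm Pc [l c].
have P0 : P 0 by have := PZ (-1) _ _ Pc Pc; rewrite scaleN1r addNr.
have PD x y : P x -> P y -> P (x + y) by move=> /PZ /[apply] /(_ 1); rewrite scale1r.
pose x0 : heis h := (l, 0).
have -> : (l, c) = (c : K) *: heis_central h + x0.
  by congr pair; rewrite /= ?scaler0 ?add0r // addr0 [RHS]mulr1.
apply: PZ => //; rewrite /x0 [l]loop_sumE.
elim: (enum_fset _) => [|n s IH]; first by rewrite big_nil; exact: P0.
rewrite big_cons.
set l' := \sum_(_ <- _) _ in IH *.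
have -> : (loop_monomial (l n) n + l', 0) = heis_mode (l n) n + (l', 0) :> heis h.
  by congr pair; rewrite /= addr0.
exact: PD.
Qed.

Lemma heis_mode_is_linear n : linear (fun b : h => heis_mode b n).
Proof.
move=> a b c; rewrite /heis_mode loop_monomial_is_linear; congr pair.
by rewrite /= scaler0 addr0.
Qed.

Lemma heis_linear_ext (L : lmodType K) (f g : heis h -> L) :
    linear f -> linear g -> (forall b n, f (heis_mode b n) = g (heis_mode b n)) ->
  f (heis_central h) = g (heis_central h) -> f =1 g.
Proof.
by move=> fL gL fg fgc; apply: heis_ind => // a x y fx fy; rewrite fL gL fx fy.
Qed.

Lemma heis_bracket_sum (x y : heis h) :
  heis_bracket B x y =
  (0, loop_sum (fun m b => m%:~R * B b (y.1 (- m)) : K^o) x.1).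
Proof. by []. Qed.

Lemma form_linearl c : linear (fun b => B b c : K^o).
Proof. by move=> a b b'; rewrite linearPl. Qed.

Lemma heis_bracket_linearl y : linear (fun x : heis h => heis_bracket B x y).
Proof.
move=> a x x'; rewrite !heis_bracket_sum; congr pair.
  by rewrite /= scaler0 addr0.
apply: loop_sum_is_linear => n c b b'; rewrite form_linearl.
by rewrite mulrDr; congr (_ + _); rewrite [LHS]mulrCA.
Qed.

Lemma heis_bracket_mode b m y :
  heis_bracket B (heis_mode b m) y = (0, m%:~R * B b (y.1 (- m))).
Proof.
rewrite heis_bracket_sum loop_sum_monomial // => n a c c'.
by rewrite form_linearl mulrDr; congr (_ + _); rewrite [LHS]mulrCA.
Qed.

Lemma heis_bracket_central y : heis_bracket B (heis_central h) y = 0.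
Proof.
rewrite heis_bracket_sum; congr pair; apply: fsbig1 => n _ /=.
by rewrite linear0l mulr0.
Qed.

Lemma heis_bracket_linearr b m : linear (heis_bracket B (heis_mode b m)).
Proof.
move=> a x y; rewrite !heis_bracket_mode; congr pair.
  by rewrite /= scaler0 addr0.
by rewrite /= linearP mulrDr; congr (_ + _); rewrite [LHS]mulrCA.
Qed.

Lemma heis_bracket_mode_central b m :
  heis_bracket B (heis_mode b m) (heis_central h) = 0.
Proof. by rewrite heis_bracket_mode /= linear0 mulr0. Qed.

End HeisenbergAlgebra.

(** * The modules [M(1, lambda)] and their universal property *)

Section HeisenbergModule.
Context (K : fieldType) (h : vectType K) (B : {symmetric h}) (lambda : h).
Local Notation br := (heis_bracket B).
Local Notation M := (heis_module B lambda).
Local Notation vac := (heis_vec B lambda).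

Definition heis_act (x : heis h) : M -> M := left_act (uea_in br x : heis_uea B).

Lemma heis_opE b n : heis_op b n = heis_act (heis_mode b n).
Proof. by []. Qed.

Lemma heis_act_linearr x : linear (heis_act x).
Proof. by apply: left_act_linearr => a v; exact: uea_scaler. Qed.

Lemma heis_act_linearl v : linear (fun x => heis_act x v).
Proof. by move=> a x y; rewrite /heis_act linearP; exact: left_act_linearl. Qed.

Lemma heis_op_linear b n : linear (@heis_op K h B lambda b n).
Proof. exact: heis_act_linearr. Qed.

Lemma heis_op_linearl n v : linear (fun b => @heis_op K h B lambda b n v).
Proof.
by move=> a b c; rewrite !heis_opE heis_mode_is_linear heis_act_linearl.
Qed.

Lemma heis_act_bracket x y v :
  heis_act x (heis_act y v) - heis_act y (heis_act x v) = heis_act (br x y) v.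
Proof.
rewrite /heis_act -!left_actM -uea_in_commutator.
by rewrite (linearB_of (left_act_linearl v)).
Qed.

Lemma heis_module_act_ind (P : M -> Prop) :
    (forall a v w, P v -> P w -> P (a *: v + w)) -> P vac ->
    (forall x v, P v -> P (heis_act x v)) -> forall v, P v.
Proof.
move=> PZ Pvac Pact v; have [u ->] := left_piP v.
elim/uea_ind: u => [|a u w Pu Pw|x u Pu] //; first by rewrite linearP; apply: PZ.
by rewrite -left_actE; exact: Pact.
Qed.

(** The relation [K - 1] concerns only the generating vector; since [K] is central, the identity is
    transported along the action to all vectors. *)
Lemma heis_central_act v : heis_act (heis_central h) v = v.
Proof.
elim/heis_module_act_ind: v => [a v w Pv Pw||x v Pv].
- by rewrite heis_act_linearr Pv Pw.
- apply/eqP; rewrite -subr_eq0; apply/eqP.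
  rewrite -[X in _ - X]left_act1 -(linearB_of (left_act_linearl _)).
  by apply: left_act_rel; apply: Or33.
- apply/eqP; rewrite -{2}Pv -subr_eq0 heis_act_bracket heis_bracket_central.
  by rewrite (linear0_of (heis_act_linearl v)).
Qed.

Lemma heis_op_commutator b c m n v :
  @heis_op K h B lambda b m (heis_op c n v) =
  heis_op c n (heis_op b m v) + (m%:~R * B b c * (m + n == 0)%:R) *: v.
Proof.
apply/eqP; rewrite addrC -subr_eq !heis_opE heis_act_bracket heis_bracketE.
by rewrite (linearZ_of (heis_act_linearl v)) heis_central_act.
Qed.

Lemma heis_op_vac b (n : int) : 1 <= n -> heis_op b n vac = 0.
Proof.
by move=> n1; apply: left_act_rel; apply: Or31; exists b, n.
Qed.

(** Zero modes commute with the whole algebra, their bracket carrying the factor [m = 0], so the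
    relation on the vacuum spreads as it does for [K]. *)
Lemma heis_op0 b (v : M) : heis_op b 0 v = B b lambda *: v.
Proof.
elim/heis_module_act_ind: v => [a v w Pv Pw||x v Pv].
- by rewrite heis_op_linear Pv Pw scalerDr !scalerA mulrC.
- apply/eqP; rewrite -subr_eq0; apply/eqP.
  rewrite -[X in _ *: X]left_act1 -(linearZ_of (left_act_linearl _)).
  rewrite -(linearB_of (left_act_linearl _)).
  by apply: left_act_rel; apply: Or32; exists b.
- apply/eqP; rewrite -(linearZ_of (heis_act_linearr x)) -Pv !heis_opE.
  rewrite -subr_eq0 heis_act_bracket heis_bracket_mode mul0r.
  by rewrite (linear0_of (heis_act_linearl v)).
Qed.

Lemma heis_module_ind (d : nat) (alpha : d.-tuple h) (P : M -> Prop) :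
    basis_of {:h} alpha ->
    (forall a v w, P v -> P w -> P (a *: v + w)) -> P vac ->
    (forall i n v, P v -> P (heis_op (tnth alpha i) n v)) -> forall v, P v.
Proof.
move=> alpha_basis PZ Pvac Pop; apply: heis_module_act_ind => // x v Pv.
have P0 : P 0 by have := PZ (-1) _ _ Pvac Pvac; rewrite scaleN1r addNr.
elim/heis_ind: x => [a x y Px Py|b n|]; last by rewrite heis_central_act.
  by rewrite heis_act_linearl; apply: PZ.
rewrite -heis_opE (coord_basis alpha_basis (memvf b)).
rewrite (linear_sum_of (heis_op_linearl n v)) /=.
elim/big_ind: _ => // [w w' Pw Pw'|i _]; first by rewrite -[w]scale1r; apply: PZ.
rewrite (linearZ_of (heis_op_linearl n v)) -[X in P X]addr0; apply: PZ => //.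
by rewrite -tnth_nth; exact: Pop.
Qed.

Section Lift.
Context (F : lmodType K) (rho : heis h -> F -> F) (v0 : F).
Hypothesis rho_linearl : forall f, linear (fun x => rho x f).
Hypothesis rho_linearr : forall x, linear (rho x).
Hypothesis rho_bracket :
  forall x y f, rho x (rho y f) - rho y (rho x f) = rho (br x y) f.
Hypothesis rho_central : forall f, rho (heis_central h) f = f.
Hypothesis rho_pos : forall b (n : int), 1 <= n -> rho (heis_mode b n) v0 = 0.
Hypothesis rho0 : forall b, rho (heis_mode b 0) v0 = B b lambda *: v0.

(** Universal property of [M(1, lambda)]: a representation of level 1 with a vector [v0] obeying the
    highest weight relations receives a unique equivariant map sending the vacuum to [v0]. *)
Definition heis_lift : M -> F :=
  @left_quot_lift _ _ _ F (@uea_act K (heis h) br F rho) v0.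

Let actl f := uea_act_linearl rho_linearl rho_linearr rho_bracket f.
Let actr u := @uea_act_linearr K (heis h) br F rho rho_linearr u.
Let actM u v f := uea_actM rho_linearl rho_linearr rho_bracket u v f.
Let acti x f := uea_act_in rho_linearl rho_linearr rho_bracket x f.
Let act1 f := uea_act1 rho_linearl rho_linearr rho_bracket f.

Let act_rel (u : heis_uea B) : highest_weight_relations lambda u -> uea_act rho u v0 = 0.
Proof.
case=> [[b [n [n1 ->]]]|[b ->]|->]; first by rewrite acti rho_pos.
  rewrite (linearB_of (actl v0)) acti rho0 (linearZ_of (actl v0)).
  by rewrite act1 subrr.
by rewrite (linearB_of (actl v0)) acti act1 rho_central subrr.
Qed.

Lemma heis_lift_linear : linear heis_lift.
Proof. exact: left_quot_lift_linear actl actr actM act_rel. Qed.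

Lemma heis_lift_vac : heis_lift vac = v0.
Proof.
by rewrite /heis_lift (left_quot_liftE actl actr actM act_rel) act1.
Qed.

Lemma heis_lift_op b n v :
  heis_lift (heis_op b n v) = rho (heis_mode b n) (heis_lift v).
Proof.
rewrite /heis_lift (left_quot_lift_act actl actr actM act_rel).
exact: acti.
Qed.

End Lift.

End HeisenbergModule.

(** * Fock space *)

Section FockOperators.
Context (K : fieldType) (d : nat) (lam : 'I_d -> K).
Local Notation X := {cmonom ('I_d * nat)%type}.
Local Notation F := {malg K[X]}.
Implicit Types (p q : ('I_d * nat)%type) (k l : X) (f g : F).

(* Locked: comparing distinct monomials up to conversion does not terminate in
   reasonable time. *)
Fact fock_key : unit. Proof. by []. Qed.
Definition fock_vec : X -> F := locked_with fock_key (fun k => << k >>).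

Lemma fock_vecE k : fock_vec k = << k >>.
Proof. by rewrite /fock_vec locked_withE. Qed.

Lemma fock_lift_vec (L : lmodType K) (u : X -> L) k : malg_lift u (fock_vec k) = u k.
Proof. by rewrite fock_vecE malg_liftU. Qed.

Lemma fock_linear_ext (L : lmodType K) (u v : F -> L) : linear u -> linear v ->
  (forall k, u (fock_vec k) = v (fock_vec k)) -> u =1 v.
Proof.
by move=> uL vL uv; apply: malg_linear_ext => // k; rewrite -fock_vecE.
Qed.

Definition fock_raise p (f : F) : F := malg_lift (fun k => fock_vec (mmul (ucm p) k)) f.

(** The partial derivative in [x_p]. If [p] does not occur in [k], the truncated quotient is [k]
    itself and the factor [(k p)%:R = 0] removes it. *)
Definition fock_lower p (f : F) : F :=
  malg_lift (fun k => (k p)%:R *: fock_vec (divcm k (ucm p))) f.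

Lemma fock_raise_linear p : linear (fock_raise p).
Proof. exact: malg_lift_is_linear. Qed.

Lemma fock_lower_linear p : linear (fock_lower p).
Proof. exact: malg_lift_is_linear. Qed.

Lemma fock_raiseU p k : fock_raise p (fock_vec k) = fock_vec (mmul (ucm p) k).
Proof. exact: fock_lift_vec. Qed.

Lemma fock_lowerU p k : fock_lower p (fock_vec k) = (k p)%:R *: fock_vec (divcm k (ucm p)).
Proof. exact: fock_lift_vec. Qed.

Lemma cmonom_eq k l : (forall p, k p = l p) -> k = l.
Proof. by move=> kl; apply/eqP/cmP. Qed.

Lemma mul_divcm p k : (0 < k p)%N -> mmul (ucm p) (divcm k (ucm p)) = k.
Proof.
move=> k_gt0; apply: cmonom_eq => q; rewrite cmM divcmE cmU.
by case: eqVneq => [<-|_] /=; rewrite ?subnKC // subn0.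
Qed.

Lemma div_mulcm p k : divcm (mmul (ucm p) k) (ucm p) = k.
Proof. by apply: cmonom_eq => q; rewrite divcmE cmM cmU addKn. Qed.

Lemma fock_raiseC p q f :
  fock_raise p (fock_raise q f) = fock_raise q (fock_raise p f).
Proof.
move: f; apply: fock_linear_ext => [||k];
  [exact: linear_comp_of (fock_raise_linear _) (fock_raise_linear _)..|].
rewrite (fock_raiseU q k) (fock_raiseU p k) (fock_raiseU p) (fock_raiseU q).
by rewrite !mulmA [mmul (ucm p) (ucm q)]mulmC.
Qed.

Lemma fock_lowerC p q f :
  fock_lower p (fock_lower q f) = fock_lower q (fock_lower p f).
Proof.
move: f; apply: fock_linear_ext => [||k];
  [exact: linear_comp_of (fock_lower_linear _) (fock_lower_linear _)..|].
rewrite (fock_lowerU q k) (fock_lowerU p k).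
rewrite (linearZ_of (fock_lower_linear p)) (linearZ_of (fock_lower_linear q)).
rewrite (fock_lowerU p) (fock_lowerU q) !scalerA.
have [-> //|pq] := eqVneq p q.
rewrite !divcmE !cmU (negPf pq) eq_sym (negPf pq) !subn0 mulrC.
suff -> : divcm (divcm k (ucm q)) (ucm p) = divcm (divcm k (ucm p)) (ucm q) by [].
by apply: cmonom_eq => r; rewrite !divcmE subnAC.
Qed.

Lemma fock_lower_raise p q f :
  fock_lower p (fock_raise q f) = fock_raise q (fock_lower p f) + (p == q)%:R *: f.
Proof.
move: f; apply: fock_linear_ext => [||k].
- exact: linear_comp_of (fock_lower_linear _) (fock_raise_linear _).
- apply: linear_add_of; last exact: linear_scaler_of.
  exact: linear_comp_of (fock_raise_linear _) (fock_lower_linear _).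
rewrite (fock_raiseU q k) (fock_lowerU p k) (fock_lowerU p).
rewrite (linearZ_of (fock_raise_linear q)) (fock_raiseU q) cmM cmU; have [->|pq] := eqVneq p q.
  rewrite div_mulcm addnC natrD; have [->|k_gt0] := posnP (k q).
    by rewrite scale0r !add0r.
  by rewrite mul_divcm // scalerDl.
rewrite scale0r addr0 add0n.
suff -> : divcm (mmul (ucm q) k) (ucm p) = mmul (ucm q) (divcm k (ucm p)) by [].
apply: cmonom_eq => r; rewrite !(divcmE, cmM) !cmU.
by case: (eqVneq q r) => [<-|_]; rewrite ?(negPf pq) /= ?subn0.
Qed.

(** The variable [(i, m)] belongs to the modes [m + 1] and [-(m + 1)]; since [Negz m] is [-(m + 1)],
    both signs use the same index. *)
Definition fock_mode (i : 'I_d) (n : int) (f : F) : F :=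
  match n with
  | Posz 0 => lam i *: f
  | Posz m.+1 => m.+1%:R *: fock_lower (i, m) f
  | Negz m => fock_raise (i, m) f
  end.

Lemma fock_mode_linear i n : linear (fock_mode i n).
Proof.
case: n => [[|m]|m] /=; last exact: fock_raise_linear.
  exact: linear_scaler_of.
exact: linear_scale_of (fock_lower_linear _).
Qed.

Lemma fock_mode_commutator i j m n f :
  fock_mode i m (fock_mode j n f) - fock_mode j n (fock_mode i m f) =
  (m%:~R * (i == j)%:R * (m + n == 0)%:R) *: f.
Proof.
have zero_mode c r : fock_mode i r (c *: f) = c *: fock_mode i r f.
  exact: linearZ_of (fock_mode_linear i r) _ _.
(* Equality of variables splits into equality of the basis indices and vanishing of the sum of the
   modes, the two deltas of the Heisenberg bracket. *)
have pair_delta (i' j' : 'I_d) m' n' :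
    ((i', m') == (j', n'))%:R = (i' == j')%:R * (m'.+1%:Z + Negz n' == 0)%:R :> K.
  by rewrite -natrM mulnb xpair_eqE NegzE subr_eq0.
case: m => [[|m]|m] /=.
- rewrite (linearZ_of (fock_mode_linear j n)) subrr.
  by rewrite mulr0z !mul0r scale0r.
- case: n => [[|n]|n] /=.
  + by rewrite (linearZ_of (fock_lower_linear _)) !scalerA mulrC subrr mulr0 scale0r.
  + rewrite !(linearZ_of (fock_lower_linear _)) !scalerA fock_lowerC mulrC subrr.
    by rewrite mulr0 scale0r.
  + rewrite fock_lower_raise scalerDr (linearZ_of (fock_raise_linear _)) addrAC subrr.
    by rewrite add0r scalerA pair_delta mulrA.
- case: n => [[|n]|n] /=.
  + by rewrite (linearZ_of (fock_raise_linear _)) subrr mulr0 scale0r.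
  + rewrite fock_lower_raise scalerDr (linearZ_of (fock_raise_linear _)) opprD.
    rewrite addrA subrr sub0r scalerA -scaleNr pair_delta mulrA addrC [j == i]eq_sym.
    have [mn|_] := eqVneq (n.+1%:Z + Negz m) 0; last by rewrite !mulr0 oppr0.
    have -> : Negz m = - n.+1%:Z by apply/eqP; rewrite -addr_eq0 addrC mn.
    by rewrite mulrNz !mulNr !mulr1.
  + by rewrite fock_raiseC subrr mulr0 scale0r.
Qed.


End FockOperators.

(** * From operators for an orthonormal basis to the Heisenberg algebra *)

Section HeisenbergRepresentation.
Context (K : fieldType) (h : vectType K) (B : {symmetric h}) (lambda : h).
Context (d : nat) (alpha : d.-tuple h).
Hypothesis alpha_basis : basis_of {:h} alpha.
Hypothesis alpha_orthonormal :
  forall i j : 'I_d, B (tnth alpha i) (tnth alpha j) = (i == j)%:R.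
Local Notation M := (heis_module B lambda).
Local Notation vac := (heis_vec B lambda).

Lemma form_sym b c : B b c = B c b.
Proof. by rewrite (hermC B) /= expr0 mul1r. Qed.

Lemma orthonormal_expansion b : b = \sum_i B b (tnth alpha i) *: tnth alpha i.
Proof.
rewrite [LHS](coord_basis alpha_basis (memvf b)); apply: eq_bigr => i _.
rewrite -tnth_nth; congr (_ *: _).
rewrite {2}(coord_basis alpha_basis (memvf b)) (linear_sum_of (form_linearl B _)) /= (bigD1 i) //=.
rewrite linearZl_LR /= -tnth_nth alpha_orthonormal eqxx mulr1 big1 ?addr0 // => j ji.
by rewrite linearZl_LR /= -tnth_nth alpha_orthonormal (negPf ji) mulr0.
Qed.

Lemma orthonormal_form b c :
  B b c = \sum_i B b (tnth alpha i) * B c (tnth alpha i).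
Proof.
rewrite {1}[b]orthonormal_expansion (linear_sum_of (form_linearl B _)) /=; apply: eq_bigr => i _.
by rewrite linearZl_LR /= [B c _]form_sym.
Qed.

Context (F : lmodType K) (mode : 'I_d -> int -> F -> F) (v0 : F).
Hypothesis mode_linear : forall i n, linear (mode i n).
Hypothesis mode_commutator : forall i j m n f,
  mode i m (mode j n f) - mode j n (mode i m f) =
  (m%:~R * (i == j)%:R * (m + n == 0)%:R) *: f.
Hypothesis mode_pos : forall i (n : int), 1 <= n -> mode i n v0 = 0.
Hypothesis mode0 : forall i, mode i 0 v0 = B (tnth alpha i) lambda *: v0.

(** By orthonormality the pairings with [alpha] are the coordinates of [b], so this is the linear
    extension of the basis operators to [b(n)]. *)
Definition fock_vmode (n : int) (b : h) (f : F) : F :=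
  \sum_i B b (tnth alpha i) *: mode i n f.

Definition fock_rep (x : heis h) (f : F) : F :=
  (x.2 : K) *: f + loop_sum (fun n b => fock_vmode n b f) x.1.

Lemma fock_vmode_linearr n b : linear (fock_vmode n b).
Proof.
by apply: linear_bigsum_of => i; apply: linear_scale_of; apply: mode_linear.
Qed.

Lemma fock_vmode_linearl n f : linear (fun b => fock_vmode n b f).
Proof.
move=> a b c; rewrite scaler_sumr -big_split; apply: eq_bigr => i _ /=.
by rewrite linearPl scalerDl scalerA.
Qed.

Lemma fock_rep_linearl f : linear (fun x => fock_rep x f).
Proof.
move=> a x y; rewrite /fock_rep.
rewrite (loop_sum_is_linear (fun n => fock_vmode_linearl n f) a x.1 y.1).
have -> : (a *: x + y).2 = a * (x.2 : K) + y.2 by [].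
by rewrite scalerDl -(scalerA a) addrACA -(scalerDr a).
Qed.

Lemma fock_rep_mode b n f : fock_rep (heis_mode b n) f = fock_vmode n b f.
Proof.
rewrite /fock_rep scale0r add0r loop_sum_monomial // => m.
exact: fock_vmode_linearl.
Qed.

Lemma fock_rep_central f : fock_rep (heis_central h) f = f.
Proof.
rewrite /fock_rep scale1r (linear0_of (loop_sum_is_linear _)) ?addr0 // => m.
exact: fock_vmode_linearl.
Qed.

Lemma fock_rep_linearr x : linear (fock_rep x).
Proof.
move=> a f g; move: x; apply: heis_linear_ext.
- exact: fock_rep_linearl.
- apply: linear_add_of; last exact: fock_rep_linearl.
  by apply: linear_scale_of; exact: fock_rep_linearl.
- by move=> b n; rewrite !fock_rep_mode fock_vmode_linearr.
- by rewrite !fock_rep_central.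
Qed.

Lemma fock_vmode_commutator b c m n f :
  fock_vmode m b (fock_vmode n c f) - fock_vmode n c (fock_vmode m b f) =
  (m%:~R * B b c * (m + n == 0)%:R) *: f.
Proof.
rewrite /fock_vmode.
under eq_bigr do rewrite (linear_sum_of (mode_linear _ _)) scaler_sumr.
under [X in _ - X]eq_bigr do
  rewrite (linear_sum_of (mode_linear _ _)) scaler_sumr.
rewrite [X in _ - X]exchange_big /= -sumrB.
rewrite orthonormal_form mulr_sumr mulr_suml scaler_suml; apply: eq_bigr => i _.
rewrite -sumrB (bigD1 i) //= big1 ?addr0 => [|j ji];
  rewrite !(linearZ_of (mode_linear _ _)) !scalerA [B c _ * _]mulrC
    -scalerBr mode_commutator scalerA.
  by rewrite eqxx mulr1 mulrCA mulrA.
by rewrite eq_sym (negPf ji) mulr0 mul0r mulr0 scale0r.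
Qed.

Lemma fock_rep_bracket x y f :
  fock_rep x (fock_rep y f) - fock_rep y (fock_rep x f) =
  fock_rep (heis_bracket B x y) f.
Proof.
have rep0 : fock_rep 0 f = 0 by exact: linear0_of (fock_rep_linearl f).
move: x; apply: heis_linear_ext => [a x x'|a x x'|b m|].
- rewrite (fock_rep_linearl (fock_rep y f) a x x') (fock_rep_linearl f a x x').
  by rewrite (fock_rep_linearr y) scalerBr opprD addrACA.
- by rewrite heis_bracket_linearl fock_rep_linearl.
- move: y; apply: heis_linear_ext => [a x x'|a x x'|c n|].
  + rewrite (fock_rep_linearl (fock_rep (heis_mode b m) f) a x x').
    rewrite (fock_rep_linearl f a x x') (fock_rep_linearr (heis_mode b m)).
    by rewrite scalerBr opprD addrACA.
  + by rewrite heis_bracket_linearr fock_rep_linearl.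
  + rewrite heis_bracketE (linearZ_of (fock_rep_linearl f)) fock_rep_central.
    by rewrite !fock_rep_mode fock_vmode_commutator.
  + by rewrite !fock_rep_central heis_bracket_mode_central rep0 subrr.
- by rewrite !fock_rep_central heis_bracket_central rep0 subrr.
Qed.

Lemma fock_rep_pos b (n : int) : 1 <= n -> fock_rep (heis_mode b n) v0 = 0.
Proof.
move=> n1; rewrite fock_rep_mode; apply: big1 => i _.
by rewrite mode_pos // scaler0.
Qed.

Lemma fock_rep0 b :
  fock_rep (heis_mode b 0) v0 = B b lambda *: v0.
Proof.
rewrite fock_rep_mode orthonormal_form scaler_suml; apply: eq_bigr => i _.
by rewrite mode0 scalerA [B lambda _]form_sym.
Qed.

Definition to_fock : M -> F := heis_lift fock_rep v0.

Lemma to_fock_linear : linear to_fock.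
Proof.
exact: (heis_lift_linear fock_rep_linearl fock_rep_linearr fock_rep_bracket
  fock_rep_central fock_rep_pos fock_rep0).
Qed.

Lemma to_fock_vac : to_fock vac = v0.
Proof.
exact: (heis_lift_vac fock_rep_linearl fock_rep_linearr fock_rep_bracket
  fock_rep_central fock_rep_pos fock_rep0).
Qed.

Lemma to_fock_op i n v :
  to_fock (heis_op (tnth alpha i) n v) = mode i n (to_fock v).
Proof.
rewrite /to_fock (heis_lift_op fock_rep_linearl fock_rep_linearr fock_rep_bracket
  fock_rep_central fock_rep_pos fock_rep0) fock_rep_mode.
rewrite /fock_vmode (bigD1 i) //= alpha_orthonormal eqxx scale1r big1 ?addr0 //.
by move=> j ji; rewrite alpha_orthonormal eq_sym (negPf ji) scale0r.
Qed.

End HeisenbergRepresentation.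

(** * Hermitian forms and adjoint operators on Fock space *)

Section HermitianForms.
Context (C : numClosedFieldType) (V : lmodType C) (form : V -> V -> C).
Hypothesis form_linear : forall v, linear (fun u => form u v : C^o).
Hypothesis form_herm : forall u v, form u v = (form v u)^*.

Lemma hermitian_scale_adjoint a : a^* = a ->
  forall u v, form (a *: u) v = form u (a *: v).
Proof.
move=> a_real u v; rewrite [RHS]form_herm.
rewrite (linearZ_of (form_linear v)) (linearZ_of (form_linear u)).
by rewrite [in RHS]/(_ *: _) /= rmorphM /= a_real -form_herm.
Qed.

Lemma hermitian_adjoint_sym (r l : V -> V) :
    (forall u v, form (r u) v = form u (l v)) ->
  forall u v, form (l u) v = form u (r v).
Proof. by move=> rl u v; rewrite form_herm -rl -form_herm. Qed.

End HermitianForms.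

Section FockForm.
Context (C : numClosedFieldType) (d : nat) (lam : 'I_d -> C).
Local Notation I := ('I_d * nat)%type.
Local Notation X := {cmonom I}.
Local Notation F := {malg C[X]}.
Implicit Types (p : I) (k l : X) (f g : F).

Definition fock_norm (k : X) : nat :=
  (\prod_(p <- finsupp k) ((k p)`! * p.2.+1 ^ k p))%N.

Lemma fock_normEw (D : {fset I}) k : (finsupp k `<=` D)%fset ->
  fock_norm k = (\prod_(p <- D) ((k p)`! * p.2.+1 ^ k p))%N.
Proof.
move=> kD; rewrite /fock_norm (big_fset_incl _ kD) //= => p _.
by rewrite -cmE_eq0 => /eqP ->.
Qed.

(** The factor is the one that [n d/dx_p], with [n = p.2.+1], produces on [x_p x^k]; this makes
    multiplication by [x_p] adjoint to it in [fock_form_raise]. *)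
Lemma fock_normU p k :
  fock_norm (mmul (ucm p) k) = (fock_norm k * ((k p).+1 * p.2.+1))%N.
Proof.
rewrite (@fock_normEw (p |` finsupp k)%fset); last by rewrite mdomD mdomU.
rewrite (@fock_normEw (p |` finsupp k)%fset k) ?fsubsetUr //.
rewrite (big_fsetD1 p (fset1U1 p _)) [in RHS](big_fsetD1 p (fset1U1 p _)).
rewrite cmM cmUU add1n factS expnS.
rewrite [X in (_ * X)%N = _](eq_big_seq (fun q : I => ((k q)`! * q.2.+1 ^ k q)%N)) => [|q].
  by rewrite mulnACA -mulnA mulnC.
by rewrite in_fsetD1 cmM cmU eq_sym => /andP[/negPf-> _].
Qed.

Lemma fock_norm_gt0 k : (0 < fock_norm k)%N.
Proof. by apply: prodn_gt0 => p; rewrite muln_gt0 fact_gt0 expn_gt0. Qed.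

Lemma mcoeff_fock_vec k l : (fock_vec C k)@_l = (k == l)%:R.
Proof. by rewrite fock_vecE mcoeffU1. Qed.

Lemma mcoeff_linear k : linear (fun f : F => f@_k : C^o).
Proof. by move=> a f g; rewrite mcoeffD mcoeffZ. Qed.

Lemma mcoeff_fock_lower p g k :
  (fock_lower p g)@_k = (k p).+1%:R * g@_(mmul (ucm p) k).
Proof.
move: g; apply: (@fock_linear_ext _ _ (C^o)) => [||l].
- exact: linear_comp_of (mcoeff_linear k) (fock_lower_linear p).
- exact: linear_scale_of (mcoeff_linear _).
rewrite fock_lowerU mcoeffZ !mcoeff_fock_vec.
(* If [x_p] does not divide [l], the truncated quotient is meaningless, but both sides vanish: one
   has the factor [l p = 0], the other compares [l] with a multiple of [x_p]. *)
have [lp|lp] := posnP (l p).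
  rewrite lp mul0r; case: eqP => [lk|_]; last by rewrite mulr0.
  by move: lp; rewrite lk cmM cmUU.
have -> : (divcm l (ucm p) == k) = (l == mmul (ucm p) k).
  by apply/eqP/eqP => [<-|->]; rewrite ?mul_divcm ?div_mulcm.
by case: eqP => [->|_]; rewrite ?mulr0 // cmM cmUU.
Qed.

Definition fock_form f g : C :=
  malg_lift (fun k => (fock_norm k)%:R * (g@_k)^* : C^o) f.

Lemma fock_form_linearl g : linear (fun f => fock_form f g : C^o).
Proof. exact: malg_lift_is_linear. Qed.

Lemma fock_form_vec k g : fock_form (fock_vec C k) g = (fock_norm k)%:R * (g@_k)^*.
Proof. exact: (@fock_lift_vec _ _ (C^o)). Qed.

Lemma fock_form_herm f g : fock_form f g = (fock_form g f)^*.
Proof.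
rewrite /fock_form (@malg_liftEw _ _ (C^o) _ (msupp f `|` msupp g)%fset f) ?fsubsetUl //.
rewrite (@malg_liftEw _ _ (C^o) _ (msupp f `|` msupp g)%fset g) ?fsubsetUr //.
rewrite rmorph_sum; apply: eq_bigr => k _.
rewrite ![_ *: _]mulrC !rmorphM /= rmorph_nat conjCK.
by rewrite mulrAC.
Qed.

Lemma fock_form_gt0 f : f != 0 -> 0 < fock_form f f.
Proof.
move=> f0; rewrite /fock_form /malg_lift.
have term_ge0 k : 0 <= f@_k * ((fock_norm k)%:R * (f@_k)^*).
  by rewrite mulrCA mulr_ge0 ?ler0n // mul_conjC_ge0.
have /fset0Pn[k kf] : msupp f != fset0 by rewrite msupp_eq0.
rewrite (big_fsetD1 k) //=; apply: ltr_pwDl; last by apply: sumr_ge0 => l _; exact: term_ge0.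
rewrite [_ *: _]mulrCA mulr_gt0 ?ltr0n ?fock_norm_gt0 // mul_conjC_gt0.
by rewrite mcoeff_neq0.
Qed.

Hypothesis lam_real : forall i, (lam i)^* = lam i.

Lemma fock_form_raise p f g :
  fock_form (fock_raise p f) g = fock_form f (p.2.+1%:R *: fock_lower p g).
Proof.
move: f; apply: (@fock_linear_ext _ _ (C^o)) => [||k].
- exact: linear_comp_of (fock_form_linearl g) (fock_raise_linear p).
- exact: fock_form_linearl.
rewrite fock_raiseU !fock_form_vec fock_normU mcoeffZ mcoeff_fock_lower.
by rewrite !rmorphM /= !rmorph_nat !natrM !mulrA [_ * (k p).+1%:R * _]mulrAC.
Qed.

Lemma fock_form_mode i n f g :
  fock_form (fock_mode lam i n f) g = fock_form f (fock_mode lam i (- n) g).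
Proof.
case: n => [[|n]|n].
- exact: (hermitian_scale_adjoint fock_form_linearl fock_form_herm (lam_real i)).
- exact: (hermitian_adjoint_sym fock_form_herm (fock_form_raise (i, n))).
- exact: (fock_form_raise (i, n) f g).
Qed.

End FockForm.

(** * Monomials and the positive definite form *)

Section Multisets.
Context (I : choiceType).
Implicit Types (k : {cmonom I}) (s : seq I).

Definition monom_of_seq s : {cmonom I} := foldr (fun p k => mmul (ucm p) k) mone s.

Definition seq_of_monom k : seq I := flatten [seq nseq (k p) p | p <- finsupp k].

Lemma monom_of_seqE s p : monom_of_seq s p = count_mem p s.
Proof.
elim: s => [|q s IH]; first exact: cm1.
by rewrite /monom_of_seq /= cmM cmU -/(monom_of_seq s) IH.
Qed.

Lemma count_seq_of_monom k p : count_mem p (seq_of_monom k) = k p.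
Proof.
rewrite /seq_of_monom count_flatten -map_comp sumnE big_map.
under eq_bigr => q _ do rewrite /= count_nseq /=.
have [pk|pk] := boolP (p \in finsupp k).
  rewrite (big_fsetD1 p) //= eqxx mul1n big1_fset ?addn0 // => q.
  by rewrite !inE => /andP[/negPf-> _] _.
rewrite big1_fset => [|q qk _]; first by apply/esym/eqP; rewrite cmE_eq0.
by case: eqP => // qp; rewrite qp (negPf pk) in qk.
Qed.

Lemma perm_seq_of_monom s : perm_eq (seq_of_monom (monom_of_seq s)) s.
Proof. by apply/allP => p _ /=; rewrite count_seq_of_monom monom_of_seqE. Qed.

End Multisets.

(** The head of [s] is located in [t] and commuted to the front. *)
Lemma perm_eq_foldr (I : eqType) (T : Type) (op : I -> T -> T) (x : T) :
    (forall p q y, op p (op q y) = op q (op p y)) ->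
  forall s t, perm_eq s t -> foldr op x s = foldr op x t.
Proof.
move=> opC; elim=> [|p s IH] t; first by move=> /perm_size/esym/size0nil ->.
move=> pst; have pt : p \in t by rewrite -(perm_mem pst) mem_head.
case/splitPr: pt pst => t1 t2; rewrite perm_sym (perm_catCA t1 [:: p]) perm_cons.
rewrite perm_sym => /IH /= ->.
by elim: t1 => //= q t1 <-; rewrite opC.
Qed.

(** * Creation monomials as a basis of [M(1, lambda)] *)

Section HeisenbergMonomials.
Context (C : numClosedFieldType) (h : vectType C) (B : {symmetric h}) (lambda : h).
Context (d : nat) (alpha : d.-tuple h).
Hypothesis alpha_basis : basis_of {:h} alpha.
Hypothesis alpha_orthonormal :
  forall i j : 'I_d, B (tnth alpha i) (tnth alpha j) = (i == j)%:R.
Local Notation I := ('I_d * nat)%type.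
Local Notation X := {cmonom I}.
Local Notation M := (heis_module B lambda).
Local Notation vac := (heis_vec B lambda).
Local Notation op i n := (@heis_op C h B lambda (tnth alpha i) n).
Implicit Types (p : I) (k : X) (s : seq I) (v w : M).

(* The index (i, n) stands for the creation operator alpha_i(-(n+1)). *)
Definition heis_mono s : M := foldr (fun p v => op p.1 (Negz p.2) v) vac s.

(** Two negative indices never add up to zero, so creation operators commute. *)
Lemma perm_heis_mono s t : perm_eq s t -> heis_mono s = heis_mono t.
Proof.
apply: perm_eq_foldr => p q v; rewrite heis_op_commutator.
suff /negPf -> : Negz p.2 + Negz q.2 != 0 by rewrite mulr0 scale0r addr0.
by rewrite !NegzE -opprD oppr_eq0.
Qed.

Lemma heis_mono_ind (P : M -> Prop) :
    (forall a v w, P v -> P w -> P (a *: v + w)) -> (forall s, P (heis_mono s)) ->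
  forall v, P v.
Proof.
move=> PZ Pmono v; move: P PZ Pmono.
(* A given [P] need not be stable under the operators. The span, written as membership in every such
   [P], is: [P] may be replaced by its composite with an operator. *)
pose spanned w := forall P : M -> Prop,
  (forall a v w, P v -> P w -> P (a *: v + w)) -> (forall s, P (heis_mono s)) -> P w.
suff: spanned v by [].
apply: (heis_module_ind (P := spanned) alpha_basis) => [a {}v w Pv Pw||i n {}v Pv] P PZ Pmono.
- by apply: (PZ); [apply: Pv|apply: Pw].
- exact: (Pmono [::]).
have P0 : P 0 by have := PZ (-1) _ _ (Pmono [::]) (Pmono [::]); rewrite scaleN1r addNr.
have Pscale a w : P w -> P (a *: w) by move=> Pw; rewrite -[_ *: _]addr0; apply: PZ.
apply: (Pv (fun v => P (op i n v))) => [a w w' Pw Pw'|s].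
  by rewrite heis_op_linear; apply: PZ.
case: n => [[|n]|n]; last exact: (Pmono ((i, n) :: s)).
  by rewrite heis_op0; apply: Pscale; exact: Pmono.
(* An annihilation operator moves to the right, leaving multiples of monomials with one factor less,
   until it kills the vacuum. [P] varies because it absorbs each creation operator that is
   passed. *)
elim: s P {Pv} PZ Pmono P0 Pscale => [|p s IH] P PZ Pmono P0 Pscale.
  by rewrite heis_op_vac.
rewrite [heis_mono _]/= heis_op_commutator addrC; apply: (PZ); first exact: Pmono.
apply: (IH (fun v => P (op p.1 (Negz p.2) v))) => [a w w' Pw Pw'|t||a w Pw].
- by rewrite heis_op_linear; apply: PZ.
- exact: (Pmono (p :: t)).
- by rewrite (linear0_of (heis_op_linear _ _)).
- by rewrite (linearZ_of (heis_op_linear _ _)); apply: Pscale.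
Qed.

Let lam i := B (tnth alpha i) lambda.
Let F := {malg C[X]}.

Definition heis_to_fock : M -> F := to_fock alpha (fock_mode lam) (fock_vec C mone).

Let mode_pos i (n : int) : 1 <= n -> fock_mode lam i n (fock_vec C mone) = 0.
Proof.
case: n => [[|n]|n] // _.
change (n.+1%:R *: fock_lower (i, n) (fock_vec C mone) = 0 :> F).
by rewrite fock_lowerU cm1 scale0r scaler0.
Qed.

Let mode0 i : fock_mode lam i 0 (fock_vec C mone) = lam i *: fock_vec C mone.
Proof. by []. Qed.

Lemma heis_to_fock_linear : linear heis_to_fock.
Proof.
exact: (to_fock_linear alpha_basis alpha_orthonormal (fock_mode_linear lam)
  (fock_mode_commutator lam) mode_pos mode0).
Qed.

Lemma heis_to_fock_vac : heis_to_fock vac = fock_vec C mone.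
Proof.
exact: (to_fock_vac alpha_basis alpha_orthonormal (fock_mode_linear lam)
  (fock_mode_commutator lam) mode_pos mode0).
Qed.

Lemma heis_to_fock_op i n v :
  heis_to_fock (op i n v) = fock_mode lam i n (heis_to_fock v).
Proof.
exact: (to_fock_op alpha_basis alpha_orthonormal (fock_mode_linear lam)
  (fock_mode_commutator lam) mode_pos mode0).
Qed.

Lemma heis_to_fock_mono s : heis_to_fock (heis_mono s) = fock_vec C (monom_of_seq s).
Proof.
elim: s => [|[i n] s IH]; first exact: heis_to_fock_vac.
rewrite /heis_mono /= heis_to_fock_op -/(heis_mono s) IH.
exact: fock_raiseU.
Qed.

Definition heis_coef k v : C := (heis_to_fock v)@_k.

Lemma heis_coef_linear k : linear (fun v => heis_coef k v : C^o).
Proof. exact: linear_comp_of (mcoeff_linear k) heis_to_fock_linear. Qed.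

Lemma heis_coef_mono k s : heis_coef k (heis_mono s) = (monom_of_seq s == k)%:R.
Proof. by rewrite /heis_coef heis_to_fock_mono mcoeff_fock_vec. Qed.

Lemma heis_coef_op k i n v :
  heis_coef k (op i n.+1 v) =
  n.+1%:R * ((k (i, n)).+1%:R * heis_coef (mmul (ucm (i, n)) k) v).
Proof.
rewrite /heis_coef heis_to_fock_op.
change ((n.+1%:R *: fock_lower (i, n) (heis_to_fock v))@_k =
  n.+1%:R * ((k (i, n)).+1%:R * heis_coef (mmul (ucm (i, n)) k) v)).
by rewrite mcoeffZ mcoeff_fock_lower.
Qed.

(** Sending [x^k] to an ordered creation monomial is a left inverse of [heis_to_fock], as is seen on
    the spanning monomials. This plays the role of the Poincare-Birkhoff-Witt theorem. *)
Lemma heis_expansion v :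
  v = \sum_(k <- msupp (heis_to_fock v)) heis_coef k v *: heis_mono (seq_of_monom k).
Proof.
pose u k := heis_mono (seq_of_monom k).
suff: malg_lift u (heis_to_fock v) = v by move=> {1}<-.
elim/heis_mono_ind: v => [a v w Pv Pw|s].
  exact: etrans (linear_comp_of (malg_lift_is_linear u) heis_to_fock_linear a v w)
    (congr2 (fun x y => a *: x + y) Pv Pw).
rewrite (heis_to_fock_mono s) (fock_lift_vec u); apply: perm_heis_mono.
exact: perm_seq_of_monom.
Qed.

Lemma heis_coef_inj v : (forall k, heis_coef k v = 0) -> v = 0.
Proof.
by move=> v0; rewrite [v]heis_expansion big1 // => k _; rewrite v0 scale0r.
Qed.

Lemma heis_vec_neq0 : vac != 0.
Proof.
apply/eqP => vac0; have := heis_coef_mono mone [::].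
rewrite /heis_mono /= vac0 (linear0_of (heis_coef_linear _)) eqxx => /esym/eqP.
by rewrite oner_eq0.
Qed.

(** The degree counts the factors of a monomial and is not its weight. Every annihilation operator
    lowers it by one, whatever its index, which drives the induction for irreducibility. *)
Lemma heis_coef_degree v : exists N, forall k, (N <= mdeg k)%N -> heis_coef k v = 0.
Proof.
elim/heis_mono_ind: v => [a v w [N vN] [N' wN]|s].
  exists (maxn N N') => k; rewrite geq_max => /andP[/vN v0 /wN w0].
  by rewrite heis_coef_linear v0 w0 scaler0 addr0.
exists (mdeg (monom_of_seq s)).+1 => k; rewrite heis_coef_mono.
by case: eqP => // <-; rewrite ltnn.
Qed.

End HeisenbergMonomials.

Lemma hermitian_dot (C : numClosedFieldType) (V : lmodType C) (f : V -> V -> C) :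
    (forall v, linear (fun u => f u v : C^o)) ->
    (forall u v, f u v = (f v u)^*) -> (forall u, u != 0 -> 0 < f u u) ->
  exists form : {dot V for (@Num.conj C)}, forall u v, form u v = f u v.
Proof.
move=> f_linear f_herm f_pos.
have f_bilinear : bilinear_for (GRing.Scale.Law.clone _ _ ( *%R ) _)
    (GRing.Scale.Law.clone _ _ (Num.conj \; *%R) _) f.
  split=> [v a u u'|u a v v']; first exact: f_linear.
  have E : f (a *: v + v') u = a * f v u + f v' u by exact: f_linear.
  by rewrite f_herm E rmorphD rmorphM /= -!f_herm.
have herm u v : f u v = (-1) ^+ false * Num.conj (f v u).
  by rewrite expr0 mul1r f_herm.
pose m1 := bilinear_isBilinear.Build C V V C _ _ f f_bilinear.
pose m2 := isHermitianSesquilinear.Build C V false Num.conj f herm.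
pose m3 := isDotProduct.Build C V f f_pos.
pose F : {dot V for (@Num.conj C)} := HB.pack f m1 m2 m3.
by exists F.
Qed.

(** * The positive definite form, weight spaces and submodules *)

Section HeisenbergStructure.
Context (C : numClosedFieldType) (h : vectType C) (B : {symmetric h}) (lambda : h).
Context (d : nat) (alpha : d.-tuple h).
Hypothesis alpha_basis : basis_of {:h} alpha.
Hypothesis alpha_orthonormal :
  forall i j : 'I_d, B (tnth alpha i) (tnth alpha j) = (i == j)%:R.
Local Notation I := ('I_d * nat)%type.
Local Notation X := {cmonom I}.
Local Notation M := (heis_module B lambda).
Local Notation vac := (heis_vec B lambda).
Local Notation op i n := (@heis_op C h B lambda (tnth alpha i) n).
Local Notation mono := (heis_mono B lambda alpha).
Local Notation coef := (heis_coef alpha).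
Implicit Types (p : I) (k : X) (s : seq I) (v w : M).

Let coef_linear k := @heis_coef_linear C h B lambda d alpha alpha_basis alpha_orthonormal k.
Let coef_op := @heis_coef_op C h B lambda d alpha alpha_basis alpha_orthonormal.
Let coef_inj := @heis_coef_inj C h B lambda d alpha alpha_basis alpha_orthonormal.
Let coef_mono := @heis_coef_mono C h B lambda d alpha alpha_basis alpha_orthonormal.
Let expansion := @heis_expansion C h B lambda d alpha alpha_basis alpha_orthonormal.
Let to_fock_linear_ :=
  @heis_to_fock_linear C h B lambda d alpha alpha_basis alpha_orthonormal.

(** The Fock form is pulled back along [heis_to_fock]; it stays positive definite because the
    coefficients separate vectors. *)
Lemma heis_dot : (forall i, (B (tnth alpha i) lambda)^* = B (tnth alpha i) lambda) ->
  exists form : {dot M for (@Num.conj C)},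
    forall i n u v, form (op i n u) v = form u (op i (- n) v).
Proof.
move=> lam_real; pose f (u v : M) := fock_form (heis_to_fock alpha u) (heis_to_fock alpha v).
have f_linear v : linear (fun u : M => f u v : C^o).
  exact: linear_comp_of (fock_form_linearl (heis_to_fock alpha v)) to_fock_linear_.
have f_herm (u v : M) : f u v = (f v u)^* by exact: fock_form_herm.
have f_pos (u : M) : u != 0 -> 0 < f u u.
  move=> u0; apply: fock_form_gt0; apply: contra_neq u0 => fu0.
  by apply: coef_inj => k; rewrite /heis_coef fu0 mcoeff0.
have [form formE] := hermitian_dot f_linear f_herm f_pos.
exists form => i n u v; rewrite !formE /f.
have opE j m w := heis_to_fock_op alpha_basis alpha_orthonormal (lambda := lambda) j m w.
apply: (etrans (congr1 (fun x => fock_form x _) (opE i n u))).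
apply: (etrans (fock_form_mode lam_real i n _ _)).
exact: (congr1 (fock_form _) (esym (opE i (- n) v))).
Qed.

Definition heis_weight (s : seq I) : nat := (\sum_(p <- s) p.2.+1)%N.

(** [D] is diagonal on monomials, so an eigenvector involves only monomials of its own eigenvalue.
    With [D = L(0)] this is an induction principle that stays inside one weight space. *)
Lemma heis_weight_space (D : M -> M) (a : C) v (P : M -> Prop) :
    linear D -> (forall s, D (mono s) = (heis_weight s)%:R *: mono s) ->
    D v = a *: v ->
    P 0 -> (forall b u w, P u -> P w -> P (b *: u + w)) ->
    (forall s, (heis_weight s)%:R = a -> P (mono s)) -> P v.
Proof.
move=> D_linear D_mono Dv P0 PZ Pmono.
have coefD k w : coef k (D w) = (heis_weight (seq_of_monom k))%:R * coef k w.
  elim/(heis_mono_ind (B := B) (lambda := lambda) alpha_basis): w => [b u w Pu Pw|s].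
    rewrite D_linear (coef_linear k b (D u) (D w)) (coef_linear k b u w) Pu Pw.
    by rewrite mulrDr; congr (_ + _); rewrite [LHS]mulrCA.
  rewrite D_mono (linearZ_of (coef_linear k)) !coef_mono.
  case: eqP => [<-|_]; last by rewrite scaler0 mulr0.
  rewrite [LHS]mulr1 mulr1; congr (_%:R); apply/esym/perm_big.
  exact: perm_seq_of_monom.
rewrite [v]expansion.
elim/big_ind: _ => // [u w Pu Pw|k _]; first by rewrite -[u]scale1r; apply: PZ.
have [->|ck] := eqVneq (coef k v) 0; first by rewrite scale0r.
rewrite -[X in P X]addr0; apply: PZ => //; apply: Pmono.
by apply: (mulIf ck); rewrite -coefD Dv (linearZ_of (coef_linear k)).
Qed.

Lemma heis_submodule_full (S : set M) :
    S 0 -> (forall a v w, S v -> S w -> S (a *: v + w)) ->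
    (forall i n v, S v -> S (op i n v)) ->
  S = [set 0]%classic \/ S = setT.
Proof.
move=> S0 SZ Sop.
have SZ1 a v : S v -> S (a *: v) by move=> Sv; rewrite -[_ *: _]addr0; apply: SZ.
have full : S vac -> S = setT.
  move=> Svac; apply/seteqP; split=> // v _.
  exact: (heis_module_ind (P := S) alpha_basis).
have [[v [Sv v0]]|Sonly] := pselect (exists v, S v /\ v <> 0); last first.
  left; apply/seteqP; split=> [v Sv|v -> //].
  by apply: contrapT => v0; apply: Sonly; exists v.
right; apply: full.
have [N vN] := heis_coef_degree alpha_basis alpha_orthonormal v.
(* Induction on a strict degree bound replaces the choice of a vector of minimal degree; the bound 0
   would force [v = 0]. *)
elim: N v Sv v0 vN => [|N IH] v Sv v0 vN.
  by case: v0; apply: coef_inj => k; exact: vN.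
(* If a non-constant coefficient survives, the annihilation operator of one of its variables lowers
   the bound and turns that coefficient into a non-zero one; otherwise only the constant term is
   left. *)
have [[[i n] [k ck]]|lowest] :=
    pselect (exists p, exists k, coef (mmul (ucm p) k) v <> 0).
  apply: (IH (op i n.+1 v)); first exact: Sop.
    move=> w0; apply: ck; have := coef_op k i n v.
    rewrite w0 (linear0_of (coef_linear k)) => /esym/eqP.
    by rewrite !mulf_eq0 !pnatr_eq0 /= => /eqP.
  move=> l Nl; rewrite coef_op vN ?mulr0 //.
  by rewrite mdegM mdegU.
suff vE : v = coef mone v *: vac.
  have cv : coef mone v != 0 by apply: contra_notN v0 => /eqP c0; rewrite vE c0 scale0r.
  by rewrite -[vac]scale1r -(mulVf cv) -scalerA -vE; exact: SZ1.
apply/eqP; rewrite -subr_eq0; apply/eqP; apply: coef_inj => k.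
rewrite (linearB_of (coef_linear k)) (linearZ_of (coef_linear k)).
rewrite (coef_mono k [::]) /=.
have [<-|k1] := eqVneq mone k; first by rewrite [_ *: _]mulr1 subrr.
rewrite scaler0 subr0; apply: contrapT => ck; apply: lowest.
have [p kp] : exists p, (0 < k p)%N.
  apply: contrapT => kN; move/eqP: k1; apply; apply: cmonom_eq => p; rewrite cm1.
  by apply/esym/eqP; rewrite -leqn0 leqNgt; apply/negP => kp; apply: kN; exists p.
by exists p, (divcm k (ucm p)); rewrite mul_divcm.
Qed.

End HeisenbergStructure.

(** * Unitarity *)

Section GeneralizedBinomials.
Context (C : numClosedFieldType).
Local Notation binz := (@binz C).

Lemma binzr0 p : binz p 0 = 1.
Proof. by rewrite /Defs.binz big_ord0 fact0 divr1. Qed.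

Lemma binzS p i : i.+1%:R * binz p i.+1 = (p - i%:Z)%:~R * binz p i.
Proof.
rewrite /Defs.binz big_ord_recr /= factS natrM invfM.
have i0 : (i.+1%:R : C) != 0 by rewrite pnatr_eq0.
have f0 : (i`!%:R : C) != 0 by rewrite pnatr_eq0 -lt0n fact_gt0.
move: (\prod_(_ < i) _) (_%:~R) (i.+1%:R) (i`!%:R) i0 f0 => P x y z y0 z0.
by field; apply/andP.
Qed.

Lemma binz0r i : binz 0 i = (i == 0)%:R.
Proof.
case: i => [|i]; first by rewrite binzr0.
by rewrite /Defs.binz big_ord_recl /= subr0 mul0r mul0r.
Qed.

Lemma binzr1 p : binz p 1 = p%:~R.
Proof. by have := binzS p 0; rewrite binzr0 mul1r mulr1 subr0. Qed.

Lemma conj_binz p i : (binz p i)^* = binz p i.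
Proof.
rewrite /Defs.binz rmorphM fmorphV rmorph_nat rmorph_prod; congr (_ / _).
by apply: eq_bigr => j _; rewrite rmorph_int.
Qed.

Lemma conj_signr (n : nat) : ((-1) ^+ n : C)^* = (-1) ^+ n.
Proof. exact: rmorph_sign. Qed.

Lemma conj_sign_binz p i (n : nat) : ((-1) ^+ n * binz p i)^* = (-1) ^+ n * binz p i.
Proof. by rewrite rmorphM /= conj_signr conj_binz. Qed.

End GeneralizedBinomials.

Lemma sum_triangle_exchange (V : nmodType) (G : nat -> nat -> V) (J : nat) :
  \sum_(j < J) \sum_(s < j.+1) G (j - s)%N s = \sum_(s < J) \sum_(t < J - s) G t s.
Proof.
elim: J => [|J IH]; first by rewrite !big_ord0.
rewrite big_ord_recr /= IH.
transitivity (\sum_(s < J.+1) (\sum_(t < J - s) G t s + G (J - s)%N s)).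
  by rewrite big_split /=; congr (_ + _); rewrite big_ord_recr /= subnn big_ord0 addr0.
by apply: eq_bigr => s _; rewrite (@subSn s J) ?leq_ord // big_ord_recr.
Qed.

(** The triangle [t + s < n + N] contains the rectangle [t < n], [s < N], outside of which [G]
    vanishes. The triangle comes from expanding [L(1)^j], the rectangle from one Jacobi identity for
    each [t]. *)
Lemma sum_triangle (V : nmodType) (G : nat -> nat -> V) (n N : nat) :
    (forall t s, (n <= t)%N -> G t s = 0) -> (forall t s, (N <= s)%N -> G t s = 0) ->
  \sum_(j < n + N) \sum_(s < j.+1) G (j - s)%N s = \sum_(t < n) \sum_(s < N) G t s.
Proof.
move=> Gn GN; rewrite sum_triangle_exchange [RHS]exchange_big /=.
rewrite -(big_mkord xpredT (fun s => \sum_(t < n + N - s) G t s)).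
have tail0 : \sum_(N <= s < n + N) \sum_(t < n + N - s) G t s = 0.
  rewrite big_nat_cond big1 // => s; rewrite andbT => /andP[Ns _].
  by apply: big1 => t _; exact: GN.
rewrite (big_cat_nat (n := N)) ?leq_addl //= tail0 addr0 big_mkord.
apply: eq_bigr => s _; have nJ : (n <= n + N - s)%N by rewrite -addnBA ?leq_addr // ltnW.
rewrite -(big_mkord xpredT (fun t => G t s)) (big_cat_nat (n := n)) //=.
have -> : \sum_(n <= t < n + N - s) G t s = 0.
  by rewrite big_nat_cond big1 // => t; rewrite andbT => /andP[nt _]; exact: Gn.
by rewrite addr0 big_mkord.
Qed.

Section Antilinear.
Context (C : numClosedFieldType) (V : lmodType C) (f : V -> V).
Hypothesis f_antilinear : antilinear f.

Lemma antilinear0 : f 0 = 0.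
Proof.
have := f_antilinear 1 0 0; rewrite rmorph1 !scale1r addr0 => /eqP.
by rewrite -subr_eq subrr eq_sym => /eqP.
Qed.

Lemma antilinearD u v : f (u + v) = f u + f v.
Proof. by have := f_antilinear 1 u v; rewrite rmorph1 !scale1r. Qed.

Lemma antilinearZ c v : f (c *: v) = c^* *: f v.
Proof. by have := f_antilinear c v 0; rewrite antilinear0 !addr0. Qed.

Lemma antilinear_sum (I : Type) (r : seq I) (F : I -> V) :
  f (\sum_(i <- r) F i) = \sum_(i <- r) f (F i).
Proof. exact: (big_morph f antilinearD antilinear0). Qed.

End Antilinear.

(** * Commutators of [L(0)] and [L(1)] with the Heisenberg modes *)

Section HeisenbergVirasoro.
Context (C : numClosedFieldType) (V : lmodType C) (X : voa V).
Context (d : nat) (a : 'I_d -> V).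
Local Notation Y := (voa_mode X).
Local Notation vac := (voa_vac X).
Local Notation omega := (voa_omega X).
Local Notation L0 := (voa_vir X 0).
Local Notation L1 := (voa_vir X 1).
Local Notation binz := (@binz C).
Local Notation op i n := (Y (a i) n).
Hypothesis op_commutator : forall i j m n v,
  op i m (op j n v) =
  op j n (op i m v) + (m%:~R * (i == j)%:R * (m + n == 0)%:R) *: v.
Hypothesis op0 : forall i v, op i 0 v = 0.
Hypothesis omegaE : omega = 2^-1 *: \sum_i op i (-1) (a i).
Implicit Types (u v : V).

Lemma voa_mode_linearl n v : linear (fun u => Y u n v).
Proof. by have [? ?] := voa_bilinear X. Qed.

Lemma voa_mode_linearr u n : linear (Y u n).
Proof. by have [? ?] := voa_bilinear X. Qed.

Lemma op_state i j (n : nat) :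
  op i n.+1 (a j) = ((n == 0%N)%:R * (i == j)%:R) *: vac.
Proof.
have delta : (n.+1%:Z - 1 == 0) = (n == 0%N) by rewrite subr_eq0.
rewrite -{1}[a j](voa_creation1 X) op_commutator voa_creation //.
rewrite (linear0_of (voa_mode_linearr _ _)) add0r delta.
by have [->|_] := eqVneq n 0%N; rewrite ?mulr0 ?mul0r // mulr1.
Qed.

(** Each of the two factors of [alpha_i(-1)^2 1] contracts once with [alpha_i(1)], and the factor
    [2^-1] of [omega] cancels the resulting 2. *)
Lemma op_omega i (n : nat) : op i n omega = (n == 1%N)%:R *: a i.
Proof.
case: n => [|n]; first by rewrite op0 scale0r.
have delta : (n.+1%:Z - 1 == 0) = (n == 0%N) by rewrite subr_eq0.
rewrite omegaE (linearZ_of (voa_mode_linearr _ _)).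
rewrite (linear_sum_of (voa_mode_linearr _ _)).
have op_square j : op i n.+1 (op j (-1) (a j)) =
    ((n == 0%N)%:R * (i == j)%:R) *: (a i *+ 2).
  rewrite op_commutator op_state (linearZ_of (voa_mode_linearr _ _)).
  rewrite voa_creation1 delta.
  have [->|_] := eqVneq n 0%N; last by rewrite !(mulr0, mul0r, scale0r) addr0.
  have [->|_] := eqVneq i j; last by rewrite !(mulr0, mul0r, scale0r) addr0.
  by rewrite !mulr1 !scale1r.
under eq_bigr => j _ do rewrite op_square.
rewrite (bigD1 i) //= big1 ?addr0 => [|j ji]; last first.
  by rewrite [i == j]eq_sym (negPf ji) mulr0 scale0r.
rewrite eqxx mulr1 eqSS scalerA mulrC -scalerA; congr (_ *: _).
by rewrite -scaler_nat scalerA mulVf ?scale1r // pnatr_eq0.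
Qed.

Lemma op_virasoro i p q v :
  op i p (Y omega q v) - Y omega q (op i p v) = p%:~R *: op i (p + q - 1) v.
Proof.
(* For [r = 0] the Jacobi identity is the commutator formula: on the left only the term of index 1
   survives by [op_omega], on the right only that of index 0. [N0.+2] guarantees that both are
   present. *)
have [N0 /(_ N0.+2)] := voa_jacobi X (a i) omega v p q 0.
rewrite -addn2 leq_addr addn2 => /(_ isT).
rewrite !big_ord_recl !big1 => [|j _|j _].
- rewrite add0r op_omega /= scale0r (linear0_of (voa_mode_linearl _ _)) scaler0 add0r.
  rewrite op_omega /= scale1r binzr1 !binz0r /= mulr0 scale0r !addr0 expr0z !scale1r.
  by rewrite expr0 mulr1 scale1r => <-.
- by rewrite binz0r /= mulr0 scale0r.
- rewrite add0r op_omega /= scale0r (linear0_of (voa_mode_linearl _ _)).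
  by rewrite scaler0.
Qed.

Lemma L0_op i n v : L0 (op i n v) = op i n (L0 v) - n%:~R *: op i n v.
Proof.
have := op_virasoro i n 1 v; rewrite addrK => <-.
by rewrite -[LHS](subKr (op i n (L0 v))).
Qed.

Lemma L1_op i n v : L1 (op i n v) = op i n (L1 v) - n%:~R *: op i (n + 1) v.
Proof.
have := op_virasoro i n 2 v; rewrite -addrA => <-.
by rewrite -[LHS](subKr (op i n (L1 v))).
Qed.

Lemma L0_vac : L0 vac = 0.
Proof. exact: voa_creation. Qed.

Lemma L0_linear : linear L0.
Proof. exact: voa_mode_linearr. Qed.

Lemma L1_linear : linear L1.
Proof. exact: voa_mode_linearr. Qed.

Lemma L0_L1 v : L0 (L1 v) = L1 (L0 v) - L1 v.
Proof.
have [c /(_ 0 1 v) vir01] := voa_virasoro X.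
have {vir01}: L0 (L1 v) - L1 (L0 v) = (-1)%:~R *: L1 v + 0 by exact: vir01.
by rewrite addr0 mulrN1z scaleN1r => /eqP; rewrite subr_eq addrC => /eqP.
Qed.

Definition voa_monomial (s : seq ('I_d * nat)) : V :=
  foldr (fun p v => op p.1 (Negz p.2) v) vac s.

Lemma L0_monomial s : L0 (voa_monomial s) = (heis_weight s)%:R *: voa_monomial s.
Proof.
elim: s => [|[i n] s IH]; first by rewrite L0_vac /heis_weight big_nil scale0r.
rewrite /= L0_op IH (linearZ_of (voa_mode_linearr _ _)) NegzE mulrNz scaleNr opprK.
by rewrite -scalerDl /heis_weight big_cons natrD addrC.
Qed.

Definition divided_L1 (j : nat) (v : V) : V := (j`!)%:R^-1 *: iter j L1 v.
Local Notation T := divided_L1.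

Lemma divided_L1_0 v : T 0 v = v.
Proof. by rewrite /divided_L1 /= fact0 invr1 scale1r. Qed.

Lemma L1_divided j v : L1 (T j v) = j.+1%:R *: T j.+1 v.
Proof.
rewrite /divided_L1 (linearZ_of L1_linear) scalerA factS natrM invfM mulrA.
by rewrite mulfV ?mul1r // pnatr_eq0.
Qed.

Lemma divided_L1_op j i r v :
  T j (op i r v) = \sum_(s < j.+1) binz (- r) s *: op i (r + s%:Z) (T (j - s) v).
Proof.
elim: j => [|j IH].
  by rewrite big_ord_recl big_ord0 binzr0 !divided_L1_0 scale1r !addr0.
have j0 : (j.+1%:R : C) != 0 by rewrite pnatr_eq0.
apply: (scalerI j0); rewrite -L1_divided IH (linear_sum_of L1_linear) scaler_sumr.
pose f (s : nat) := binz (- r) s *: op i (r + s%:Z) (T (j.+1 - s) v).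
(* The factor [j.+1] is split as [(j.+1 - s) + s]: the first part comes from [L(1)] reaching [T],
   the second, with [s] shifted by one, from its commutator with the mode through [binzS]. *)
transitivity (\sum_(s < j.+2) (j.+1 - s)%:R *: f s + \sum_(s < j.+2) s%:R *: f s).
  rewrite [X in _ = X + _]big_ord_recr /= subnn scale0r addr0.
  rewrite [X in _ = _ + X]big_ord_recl /= scale0r add0r -big_split /=.
  apply: eq_bigr => s _; rewrite (linearZ_of L1_linear) L1_op L1_divided.
  rewrite -subSn ?leq_ord // (linearZ_of (voa_mode_linearr _ _)) scalerBr.
  congr (_ + _); first by rewrite /f !scalerA mulrC.
  rewrite /f /bump /= add1n subSS [RHS]scalerA binzS scalerA -scaleNr.
  by rewrite -addrA -[s.+1]addn1 PoszD -opprD mulrNz mulNr mulrC.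
rewrite -big_split; apply: eq_bigr => s _ /=.
by rewrite -scalerDl -natrD subnK // -ltnS.
Qed.

Lemma L0_divided_L1 n j v :
  L0 v = n%:R *: v -> L0 (T j v) = (n%:R - j%:R) *: T j v.
Proof.
move=> Lv; rewrite /divided_L1 (linearZ_of L0_linear) [RHS]scalerA mulrC -scalerA.
congr (_ *: _); elim: j => [|j IH]; first by rewrite subr0.
rewrite /= L0_L1 IH (linearZ_of L1_linear) -[X in _ - X]scale1r -scalerBl.
by rewrite -natr1 opprD addrA.
Qed.

Hypothesis weight_space : forall (c : C) v (P : V -> Prop), L0 v = c *: v ->
  P 0 -> (forall b u w, P u -> P w -> P (b *: u + w)) ->
  (forall s, (heis_weight s)%:R = c -> P (voa_monomial s)) -> P v.

(** [L(1)] lowers the weight by one, and no monomial has the negative weight [n - j]. *)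
Lemma divided_L1_eq0 n j v : L0 v = n%:R *: v -> (n < j)%N -> T j v = 0.
Proof.
move=> Lv nj; have LT := L0_divided_L1 j Lv.
apply: (weight_space (P := fun u => u = 0) LT) => [//|b u w -> ->|s ws].
  by rewrite scaler0 addr0.
have : (heis_weight s + j)%:R = n%:R :> C by rewrite natrD ws subrK.
by move/eqP; rewrite eqr_nat => /eqP wj; move: nj; rewrite -wj ltnNge leq_addl.
Qed.

(** * Opposite modes and invariance of the form *)

Section Adjoint.
Context (M : lmodType C) (YM : V -> int -> M -> M).
Hypothesis YM_bilinear : bilinear_modes YM.
Hypothesis YM_vacuum : forall n w, YM vac n w = if n == -1 then w else 0.
Hypothesis YM_jacobi : jacobi_identity Y YM.
Local Notation opM i n := (YM (a i) n).
Local Notation opp := (opposite_mode X YM).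

Lemma mode_linearl n w : linear (fun u => YM u n w).
Proof. by have [YMl YMr] := YM_bilinear; exact: YMl. Qed.

Lemma mode_linearr u n : linear (YM u n).
Proof. by have [YMl YMr] := YM_bilinear; exact: YMr. Qed.

(** For [p = 0] the binomials on the left of the Jacobi identity vanish beyond the first, which
    leaves the iterate formula. *)
Lemma mode_op_expansion i r u q w : exists N0, forall N, (N0 <= N)%N ->
  YM (op i r u) q w = \sum_(s < N) ((-1) ^+ s * binz r s) *:
    (opM i (r - s%:Z) (YM u (q + s%:Z) w) -
     (-1) ^ r *: YM u (q + r - s%:Z) (opM i s%:Z w)).
Proof.
have [N0 jac] := YM_jacobi (a i) u w 0 q r; exists N0.+1 => -[//|N] N0N.
have := jac N.+1 (leqW N0N); rewrite big_ord_recl big1 => [|s _]; last first.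
  by rewrite binz0r scale0r.
rewrite /= binzr0 scale1r !addr0 add0r => ->.
by apply: eq_bigr => s _; rewrite !add0r.
Qed.

Lemma opposite_linear n k w : linear (fun u => opp n u k w).
Proof.
apply: linear_bigsum_of => j; apply: linear_scale_of.
apply: (linear_comp_of (mode_linearl _ w)).
elim: {j}(nat_of_ord j) => //= j IH; exact: linear_comp_of L1_linear IH.
Qed.

(** Since [T t u = 0] for [t > n], the cut-off at the weight may be moved to any larger [J]; sums
    attached to different weights can then share a range. *)
Lemma oppositeE n J u k w : L0 u = n%:R *: u -> (n < J)%N ->
  opp n u k w =
  (-1) ^+ n *: \sum_(t < J) YM (T t u) (2 * n%:Z - 2 - k - t%:Z) w.
Proof.
move=> Lu nJ; rewrite scaler_sumr /opposite_mode.
pose F t := (-1) ^+ n *: YM (T t u) (2 * n%:Z - 2 - k - t%:Z) w.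
transitivity (\sum_(t < n.+1) F t).
  apply: eq_bigr => t _; rewrite /F /divided_L1 (linearZ_of (mode_linearl _ _)).
  by rewrite scalerA.
rewrite (big_ord_widen J F nJ) big_mkcond; apply: eq_bigr => t _.
case: ltnP => // nt; rewrite /F (divided_L1_eq0 Lu nt).
by rewrite (linear0_of (mode_linearl _ _)) scaler0.
Qed.

(** The length needed in the Jacobi identity or for truncation depends on the vector [T t u], but
    only [t <= n] matters. *)
Lemma uniform_bound (Q : nat -> nat -> Prop) n :
    (forall t, exists N0, forall N, (N0 <= N)%N -> Q t N) ->
  exists N0, forall t N, (t <= n)%N -> (N0 <= N)%N -> Q t N.
Proof.
move=> Qt; elim: n => [|n [N0 IH]].
  by have [N0 Q0] := Qt 0%N; exists N0 => t N; rewrite leqn0 => /eqP ->; exact: Q0.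
have [N1 Q1] := Qt n.+1; exists (maxn N0 N1) => t N.
rewrite leq_eqVlt geq_max => /orP[/eqP -> /andP[_]|tn /andP[N0N _]]; first exact: Q1.
exact: IH.
Qed.

Lemma op_truncated i (r : int) u :
  exists N0, forall N, (N0 <= N)%N -> op i (r + N%:Z) u = 0.
Proof.
have [K opK] := voa_truncated X (a i) u.
exists `|K - r|%N => N KN; apply: opK; rewrite addrC -lerBlDr.
by apply: le_trans (ler_norm _) _; rewrite -abszE lez_nat.
Qed.

(* The Jacobi identity with p = -r: the coefficients binz (-r) s produced by
   moving L(1)^j across a_r are those of its left-hand side. *)
Lemma opposite_op i m n u q w : L0 u = n%:R *: u ->
  exists N0, forall N, (N0 <= N)%N ->
  opp (n + m.+1) (op i (Negz m) u) q w =
  \sum_(s < N) ((-1) ^+ s * binz (Negz m) s) *: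
    ((-1) ^+ m.+1 *: opM i (- s%:Z) (opp n u (q + Negz m - s%:Z) w) -
     opp n u (q + s%:Z) (opM i (s%:Z - Negz m) w)).
Proof.
move=> Lu; set r := Negz m.
(* The second parameter is chosen so that the mode on the left is [2 (n + m.+1) - 2 - q - (t + s)]:
   the index of the opposite mode in weight [n + m.+1], depending on [t] and [s] only through
   [j = t + s]. *)
pose jac t N := \sum_(s < N) binz (- r) s *:
    YM (op i (r + s%:Z) (T t u)) (- r + (2 * n%:Z - r - 2 - q - t%:Z) - s%:Z) w =
  \sum_(s < N) ((-1) ^+ s * binz r s) *:
    (opM i (- r + r - s%:Z) (YM (T t u) (2 * n%:Z - r - 2 - q - t%:Z + s%:Z) w) -
     (-1) ^ r *: YM (T t u) (2 * n%:Z - r - 2 - q - t%:Z + r - s%:Z)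
       (opM i (- r + s%:Z) w)).
have [N1 jacN] : exists N0, forall t N, (t <= n)%N -> (N0 <= N)%N -> jac t N.
  by apply: uniform_bound => t; exact: YM_jacobi.
have [N2 truncN] : exists N0, forall t N, (t <= n)%N -> (N0 <= N)%N ->
    op i (r + N%:Z) (T t u) = 0.
  by apply: uniform_bound => t; exact: op_truncated.
(* The bound [m.+1] makes the triangle of size [n.+1 + N] reach beyond the weight [n + m.+1]; [N2]
   makes the terms with [s >= N] vanish. *)
exists (maxn m.+1 (maxn N1 N2)) => N; rewrite !geq_max => /and3P[mN N1N N2N].
have Lop : L0 (op i r u) = (n + m.+1)%:R *: op i r u.
  rewrite L0_op Lu (linearZ_of (voa_mode_linearr _ _)) /r NegzE mulrNz scaleNr opprK.
  by rewrite -scalerDl natrD.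
have nJ : (n + m.+1 < n.+1 + N)%N by rewrite addSn ltnS leq_add2l.
rewrite (oppositeE _ _ Lop nJ).
pose G t s := binz (- r) s *: YM (op i (r + s%:Z) (T t u))
  (- r + (2 * n%:Z - r - 2 - q - t%:Z) - s%:Z) w.
have Gn t s : (n < t)%N -> G t s = 0.
  move=> nt; rewrite /G (divided_L1_eq0 Lu nt) (linear0_of (voa_mode_linearr _ _)).
  by rewrite (linear0_of (mode_linearl _ _)) scaler0.
have GN t s : (N <= s)%N -> G t s = 0.
  move=> Ns; have [nt|tn] := ltnP n t; first exact: Gn.
  rewrite /G truncN ?(leq_trans N2N) // (linear0_of (mode_linearl _ _)).
  by rewrite scaler0.
transitivity ((-1) ^+ (n + m.+1) *: \sum_(t < n.+1) \sum_(s < N) G t s).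
  rewrite -(sum_triangle Gn GN); congr (_ *: _); apply: eq_bigr => j _.
  rewrite divided_L1_op (linear_sum_of (mode_linearl _ _)).
  apply: eq_bigr => s _; rewrite (linearZ_of (mode_linearl _ _)) /G.
  have -> : (j - s)%:Z = j%:Z - s%:Z by rewrite subzn // -ltnS.
  by congr (_ *: YM _ _ _); rewrite /r NegzE PoszD; ring.
under eq_bigr => t _ do rewrite (jacN t N (leq_ord t) N1N : \sum_(s < N) G t s = _).
rewrite exchange_big scaler_sumr; apply: eq_bigr => s _ /=.
rewrite -scaler_sumr scalerA [X in X *: _ = _]mulrC -[LHS]scalerA; congr (_ *: _).
rewrite !(oppositeE _ _ Lu (ltnSn n)) !(linearZ_of (mode_linearr _ _)).
rewrite (linear_sum_of (mode_linearr _ _)).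
have -> : (-1) ^ r = (-1) ^+ m.+1 :> C by rewrite /r NegzE -exprnN invr_sign.
rewrite big_split sumrN -scaler_sumr scalerBr !scalerA exprD.
have -> : (-1) ^+ n * (-1) ^+ m.+1 * (-1) ^+ m.+1 = (-1) ^+ n :> C.
  by rewrite -mulrA -expr2 sqrr_sign mulr1.
rewrite [(-1) ^+ n * _]mulrC; congr (_ *: _ - _ *: _); apply: eq_bigr => t _.
  by congr (opM _ _ (YM _ _ _)); rewrite /r; ring.
by congr (YM _ _ (opM _ _ _)); rewrite /r; ring.
Qed.

Context (phi : V -> V) (form : {dot M for (@Num.conj C)}).
Hypothesis phi_antilinear : antilinear phi.
Hypothesis phi_monomial : forall s,
  phi (voa_monomial s) = (-1) ^+ size s *: voa_monomial s.
Hypothesis op_adjoint : forall i n w1 w2,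
  form (opM i n w1) w2 = form w1 (opM i (- n) w2).

Lemma dot_linearl w : linear (fun x => form x w : C^o).
Proof. by move=> c x y; rewrite linearPl. Qed.

Lemma dotDr w x y : form w (x + y) = form w x + form w y.
Proof. exact: linearDr. Qed.

Lemma dotZr w c x : form w (c *: x) = c^* * form w x.
Proof. exact: linearZr. Qed.

Lemma dot_sumr w (I : Type) (r : seq I) (F : I -> M) :
  form w (\sum_(i <- r) F i) = \sum_(i <- r) form w (F i).
Proof. exact: linear_sumr. Qed.

(** Taking adjoints reverses the order of the two operators, so the two summands in each term of
    [opposite_op] become those of [mode_op_expansion] in exchanged order. The exchange costs a sign,
    and the coefficients are real. *)
Lemma opposite_adjoint_op i m n u (c : C) :
    L0 u = n%:R *: u ->
    (forall k w1 w2, form (opp n u k w1) w2 = c * form w1 (YM u k w2)) ->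
  forall k w1 w2, form (opp (n + m.+1) (op i (Negz m) u) k w1) w2 =
    - c * form w1 (YM (op i (Negz m) u) k w2).
Proof.
move=> Lu IH q w1 w2.
have [N1 opposite_sum] := opposite_op i m q w1 Lu.
have [N2 op_sum] := mode_op_expansion i (Negz m) u q w2.
pose N := maxn N1 N2.
rewrite (opposite_sum N (leq_maxl _ _)) (op_sum N (leq_maxr _ _)).
rewrite (linear_sum_of (dot_linearl w2)) dot_sumr mulr_sumr.
apply: eq_bigr => s _.
have -> : (-1) ^ Negz m = (-1) ^+ m.+1 :> C by rewrite NegzE -exprnN invr_sign.
rewrite (linearZ_of (dot_linearl w2)) (linearB_of (dot_linearl w2)).
rewrite (linearZ_of (dot_linearl w2)) dotZr conj_sign_binz.
rewrite -[X in form w1 (_ - X)]opprK opprK -scaleNr dotDr dotZr rmorphN /= conj_signr.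
rewrite op_adjoint opprK !IH op_adjoint opprB.
by rewrite -![_ *: _]/(_ * _); ring.
Qed.

Lemma opposite_adjoint_monomial s k w1 w2 :
  form (opp (heis_weight s) (voa_monomial s) k w1) w2 =
  (-1) ^+ size s * form w1 (YM (voa_monomial s) k w2).
Proof.
elim: s k w1 w2 => [|[i m] s IH] k w1 w2.
  rewrite /heis_weight big_nil /opposite_mode big_ord_recl big_ord0 addr0 /=.
  rewrite fact0 divr1 scale1r !YM_vacuum mul1r.
  have -> : (2 * 0 - 2 - k - 0 == -1) = (k == -1) by apply/eqP/eqP; lia.
  by case: eqP => // _; rewrite linear0l linear0r.
have -> : heis_weight ((i, m) :: s) = (heis_weight s + m.+1)%N.
  by rewrite /heis_weight big_cons addnC.
rewrite [size _]/= exprS mulN1r.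
exact: (opposite_adjoint_op i m (L0_monomial s) IH).
Qed.

(** Both sides are linear in [u], the anti-linearity of [phi] being undone by that of the second
    argument. As [opp] depends on [n], only monomials of weight [n] may enter the induction. *)
Lemma opposite_adjoint n u : L0 u = n%:R *: u ->
  forall k w1 w2, form (opp n u k w1) w2 = form w1 (YM (phi u) k w2).
Proof.
move=> Lu k w1 w2.
pose P v := form (opp n v k w1) w2 = form w1 (YM (phi v) k w2).
apply: (weight_space (P := P) Lu); rewrite /P {P}.
- rewrite (antilinear0 phi_antilinear) (linear0_of (mode_linearl _ _)).
  by rewrite (linear0_of (opposite_linear n k w1)) linear0l linear0r.
- move=> c v v' IHv IHv'; rewrite phi_antilinear (opposite_linear n k w1).
  rewrite (dot_linearl w2) IHv IHv' (mode_linearl k w2) dotDr dotZr.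
  by rewrite conjCK.
move=> s /eqP; rewrite eqr_nat => /eqP <-.
rewrite opposite_adjoint_monomial phi_monomial.
by rewrite (linearZ_of (mode_linearl _ _)) dotZr conj_signr.
Qed.

Lemma invariant_dot : invariant_form X phi YM form.
Proof.
move=> N u Lu k w1 w2; rewrite (linear_sum_of (dot_linearl w2)) (antilinear_sum phi_antilinear).
rewrite (linear_sum_of (mode_linearl _ _)) dot_sumr.
by apply: eq_bigr => n _; exact: opposite_adjoint.
Qed.

End Adjoint.

(** * The anti-linear involution *)

Section Involution.
Context (phi : V -> V).
Hypothesis phi_antilinear : antilinear phi.
Hypothesis phi_monomial : forall s,
  phi (voa_monomial s) = (-1) ^+ size s *: voa_monomial s.
Hypothesis monomial_ind : forall P : V -> Prop,
  (forall c u v, P u -> P v -> P (c *: u + v)) -> (forall s, P (voa_monomial s)) ->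
  forall v, P v.

Lemma phi_vac : phi vac = vac.
Proof. by have := phi_monomial [::]; rewrite scale1r. Qed.

Lemma phi_creation i m v : phi (op i (Negz m) v) = - op i (Negz m) (phi v).
Proof.
elim/monomial_ind: v => [c u v Pu Pv|s].
  rewrite (voa_mode_linearr (a i)) !phi_antilinear Pu Pv.
  by rewrite (voa_mode_linearr (a i)) scalerN opprD.
rewrite (phi_monomial ((i, m) :: s)) phi_monomial exprS mulN1r scaleNr.
by rewrite (linearZ_of (voa_mode_linearr _ _)).
Qed.

(** Negating every [alpha_i] preserves the Heisenberg commutators, since two signs cancel and the
    structure constants are real. Annihilation operators are therefore handled by commuting them
    down to the vacuum. *)
Lemma phi_op i n v : phi (op i n v) = - op i n (phi v).
Proof.
case: n => [[|n]|m]; first 1 [by rewrite !op0 (antilinear0 phi_antilinear) oppr0].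
  elim/monomial_ind: v => [c u v Pu Pv|s].
    rewrite (voa_mode_linearr (a i)) !phi_antilinear Pu Pv.
    by rewrite (voa_mode_linearr (a i)) scalerN opprD.
  elim: s => [|[j m] s IH].
    by rewrite phi_vac voa_creation // (antilinear0 phi_antilinear) oppr0.
  rewrite [voa_monomial _]/= -/(voa_monomial s) phi_creation (op_commutator i j n.+1).
  rewrite (antilinearD phi_antilinear) phi_creation IH (antilinearZ phi_antilinear).
  rewrite !(linearN_of (voa_mode_linearr _ _)) !opprK.
  rewrite (op_commutator i j n.+1); congr (_ + _ *: _).
  by rewrite !rmorphM /= rmorph_int !rmorph_nat.
exact: phi_creation.
Qed.

(** The iterate formula expresses the modes of a monomial through Heisenberg modes and the modes of
    a shorter monomial, with real coefficients; [phi_op] and induction then apply. *)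
Lemma phi_mode u n v : phi (Y u n v) = Y (phi u) n (phi v).
Proof.
elim/monomial_ind: u n v => [c u u' Pu Pu' n v|s].
  by rewrite voa_mode_linearl !phi_antilinear Pu Pu' voa_mode_linearl.
elim: s => [|[i m] s IH] q v.
  rewrite phi_vac !voa_vacuum; case: ifP => // _.
  exact: antilinear0 phi_antilinear.
rewrite [voa_monomial _]/= -/(voa_monomial s) phi_creation.
have [N1 E1] := mode_op_expansion (voa_jacobi X) i (Negz m)
  (voa_monomial s) q v.
have [N2 E2] := mode_op_expansion (voa_jacobi X) i (Negz m)
  (phi (voa_monomial s)) q (phi v).
rewrite (linearN_of (voa_mode_linearl _ _)).
rewrite (E1 _ (leq_maxl N1 N2)) (E2 _ (leq_maxr N1 N2)).
rewrite (antilinear_sum phi_antilinear) -sumrN; apply: eq_bigr => k _.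
rewrite (antilinearZ phi_antilinear) conj_sign_binz -[RHS]scalerN; congr (_ *: _).
have -> : (-1) ^ Negz m = (-1) ^+ m.+1 :> C by rewrite NegzE -exprnN invr_sign.
rewrite opprB addrC -[- (_ *: _)]scaleNr phi_antilinear rmorphN /= conj_signr.
rewrite phi_op !IH phi_op (linearN_of (voa_mode_linearr _ _)).
by rewrite scaleNr scalerN opprK.
Qed.

Lemma phi_involutive : involutive phi.
Proof.
elim/monomial_ind => [c u v Pu Pv|s].
  by rewrite !phi_antilinear conjCK Pu Pv.
rewrite phi_monomial (antilinearZ phi_antilinear) phi_monomial conj_signr scalerA.
by rewrite -expr2 sqrr_sign scale1r.
Qed.

Lemma phi_neq_id : ~ (phi =1 id).
Proof.
(* Anti-linearity alone sends this vector to its negative, so the argument also covers [d = 0]. *)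
move=> /(_ ('i *: vac)) /=; rewrite (antilinearZ phi_antilinear) phi_vac conjCi.
move=> /eqP; rewrite -subr_eq0 -scalerBl scaler_eq0 (negPf (voa_vac_neq0 X)) orbF.
by rewrite -opprD oppr_eq0 -mulr2n mulrn_eq0 /= (negPf (neq0Ci C)).
Qed.

Lemma phi_omega : phi omega = omega.
Proof.
have phi_state i : phi (a i) = - a i.
  by rewrite -{1}(voa_creation1 X (a i)) (phi_op i (-1)) phi_vac voa_creation1.
rewrite omegaE (antilinearZ phi_antilinear) fmorphV rmorph_nat.
rewrite (antilinear_sum phi_antilinear); congr (_ *: _); apply: eq_bigr => i _.
by rewrite phi_op phi_state (linearN_of (voa_mode_linearr _ _)) opprK.
Qed.

Lemma phi_antilinear_involution : antilinear_involution X phi.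
Proof.
split=> //; [|exact: phi_vac|exact: phi_omega|exact: phi_mode].
by split; [exact: phi_involutive|exact: phi_neq_id].
Qed.

End Involution.

End HeisenbergVirasoro.

Lemma eq_commutator (C : pzRingType) (V : lmodType C) (I : Type)
    (f g : I -> int -> V -> V) (c : I -> I -> int -> int -> C) :
  (forall i n v, f i n v = g i n v) ->
  (forall i j m n v, g i m (g j n v) = g j n (g i m v) + c i j m n *: v) ->
  forall i j m n v, f i m (f j n v) = f j n (f i m v) + c i j m n *: v.
Proof. by move=> fg gC i j m n v; rewrite !fg gC. Qed.

(** * Specialisation to the Heisenberg vertex operator algebra *)

Section HeisenbergVOAModes.
Context (C : numClosedFieldType) (h : vectType C) (B : {symmetric h}).
Context (d : nat) (alpha : d.-tuple h).
Hypothesis alpha_basis : basis_of {:h} alpha.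
Hypothesis alpha_orthonormal :
  forall i j : 'I_d, B (tnth alpha i) (tnth alpha j) = (i == j)%:R.
Context (X : voa (heis_module B 0)) (X_heisenberg : heisenberg_voa alpha X).
Local Notation V := (heis_module B 0).
Local Notation state i := (heis_state B (tnth alpha i)).
Local Notation states := (fun i : 'I_d => state i).

Lemma mode_state i n v : voa_mode X (state i) n v = heis_op (tnth alpha i) n v.
Proof. exact: (heis_voa_mode X_heisenberg). Qed.

Lemma mode_state_commutator i j m n (v : V) :
  voa_mode X (state i) m (voa_mode X (state j) n v) =
  voa_mode X (state j) n (voa_mode X (state i) m v) +
  (m%:~R * (i == j)%:R * (m + n == 0)%:R) *: v.
Proof.
pose c (i j : 'I_d) m n : C := m%:~R * (i == j)%:R * (m + n == 0)%:R.
apply: (eq_commutator (c := c) mode_state) => {}i {}j {}m {}n v'.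
by rewrite /c -alpha_orthonormal; exact: heis_op_commutator.
Qed.

Lemma mode_state0 i (v : V) : voa_mode X (state i) 0 v = 0.
Proof. by rewrite mode_state heis_op0 linear0 scale0r. Qed.

Lemma omega_states :
  voa_omega X = 2^-1 *: \sum_i voa_mode X (state i) (-1) (state i).
Proof.
rewrite (heis_voa_omega X_heisenberg); congr (_ *: _).
by apply: eq_bigr => i _; rewrite mode_state.
Qed.

Lemma voa_monomialE s : voa_monomial X states s = heis_mono B 0 alpha s.
Proof.
elim: s => [|p s IH]; first exact: (heis_voa_vac X_heisenberg).
rewrite /heis_mono /= -/(heis_mono B 0 alpha s) -IH.
exact: mode_state.
Qed.

(** The two indexings differ by one: shifted indices are automatically positive, as the condition on
    [phi] demands. *)
Lemma heis_monomialE s :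
  heis_monomial B alpha [seq (p.1, p.2.+1) | p <- s] = heis_mono B 0 alpha s.
Proof. by rewrite /heis_monomial foldr_map. Qed.

Lemma voa_weight_space (c : C) (v : V) (P : V -> Prop) : voa_vir X 0 v = c *: v ->
  P 0 -> (forall b u w, P u -> P w -> P (b *: u + w)) ->
  (forall s, (heis_weight s)%:R = c -> P (voa_monomial X states s)) -> P v.
Proof.
move=> Lv P0 PZ Pmono.
have L0_mono s : voa_vir X 0 (heis_mono B 0 alpha s) =
    (heis_weight s)%:R *: heis_mono B 0 alpha s.
  rewrite -voa_monomialE.
  exact: (L0_monomial mode_state_commutator mode_state0 omega_states).
apply: (heis_weight_space alpha_basis alpha_orthonormal (D := voa_vir X 0) (v := v)
  (P := P) (L0_linear X) L0_mono Lv P0 PZ) => s ws.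
by rewrite -voa_monomialE; exact: Pmono.
Qed.

Lemma voa_monomial_ind (P : V -> Prop) :
  (forall c u v, P u -> P v -> P (c *: u + v)) ->
  (forall s, P (voa_monomial X states s)) -> forall v, P v.
Proof.
move=> PZ Pmono; apply: (heis_mono_ind alpha_basis) => // s.
by rewrite -voa_monomialE; exact: Pmono.
Qed.

Context (phi : V -> V).
Hypothesis phi_antilinear : antilinear phi.
Hypothesis phi_monomial : forall s : seq ('I_d * nat),
  all (fun p => 0 < p.2)%N s ->
  phi (heis_monomial B alpha s) = (-1) ^+ size s *: heis_monomial B alpha s.

Lemma phi_voa_monomial s :
  phi (voa_monomial X states s) = (-1) ^+ size s *: voa_monomial X states s.
Proof.
rewrite voa_monomialE -heis_monomialE phi_monomial ?size_map //.
by rewrite all_map; apply/allP.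
Qed.

Lemma heis_antilinear_involution : antilinear_involution X phi.
Proof.
exact: (phi_antilinear_involution mode_state_commutator mode_state0 omega_states
  phi_antilinear phi_voa_monomial voa_monomial_ind).
Qed.

(** [YM] is left general so as to serve both [M(1, 0)] acting on itself, with [lambda = 0], and the
    given module structure on [M(1, lambda)]. *)
Lemma heis_unitary (lambda : h) (YM : V -> int -> heis_module B lambda -> _) :
    (forall i, (B (tnth alpha i) lambda)^* = B (tnth alpha i) lambda) ->
    bilinear_modes YM ->
    (forall n w, YM (voa_vac X) n w = if n == -1 then w else 0) ->
    jacobi_identity (voa_mode X) YM ->
    (forall i n w, YM (state i) n w = heis_op (tnth alpha i) n w) ->
  unitary_wrt X phi YM.
Proof.
move=> lambda_real YM_bilinear YM_vacuum YM_jacobi YM_state.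
have [form form_op] := heis_dot alpha_basis alpha_orthonormal lambda_real.
exists form; apply: (invariant_dot mode_state_commutator mode_state0 omega_states
  voa_weight_space YM_bilinear YM_vacuum YM_jacobi phi_antilinear phi_voa_monomial).
by move=> i n w1 w2; rewrite YM_state YM_state form_op.
Qed.

End HeisenbergVOAModes.

Theorem proposition4p10 (R : realType) (h : vectType R[i]) (B : {symmetric h})
    (d : nat) (alpha : d.-tuple h)
    (B_nondegenerate : nondegenerate B)
    (alpha_basis : basis_of {:h} alpha)
    (alpha_orthonormal : forall i j : 'I_d,
       B (tnth alpha i) (tnth alpha j) = (i == j)%:R)
    (X : voa (heis_module B 0))
    (X_heisenberg : heisenberg_voa alpha X)
    (phi : heis_module B 0 -> heis_module B 0)
    (phi_antilinear : antilinear phi)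
    (phi_monomial : forall s : seq ('I_d * nat),
       all (fun p => 0 < p.2)%N s ->
       phi (heis_monomial B alpha s) =
         (-1) ^+ size s *: heis_monomial B alpha s) :
  unitary_voa X phi /\
  (forall lambda : h, (forall i : 'I_d, 0 <= B (tnth alpha i) lambda) ->
   forall W : ordinary_module X (heis_module B lambda),
     (forall (b : h) (n : int) (w : heis_module B lambda),
        mod_mode W (heis_state B b) n w = heis_op b n w) ->
     irreducible_module W /\ unitary_module phi W).
Proof.
have unitary := heis_unitary alpha_basis alpha_orthonormal X_heisenberg
  phi_antilinear phi_monomial.
split.
  split; first exact: (heis_antilinear_involution alpha_basis alpha_orthonormal
    X_heisenberg phi_antilinear phi_monomial).
  apply: unitary (voa_bilinear X) (voa_vacuum X) (voa_jacobi X) _ => i *.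
    by rewrite linear0 conjC0.
  exact: (mode_state X_heisenberg).
move=> lambda lambda_ge0 W W_state; split; last first.
  apply: unitary (mod_bilinear W) (mod_vacuum W) (mod_jacobi W) _ => i *.
    (* In the order on [R[i]], [0 <= x] includes that [x] is real. *)
    by apply: conj_Creal; exact: ger0_real.
  exact: W_state.
split.
  exists (heis_vec B lambda); apply/eqP.
  exact: (heis_vec_neq0 lambda alpha_basis alpha_orthonormal).
move=> S S0 SZ Sop.
(* Stability under all vertex operators includes the modes of [alpha_i(-1) 1], which are the
   operators [alpha_i(n)]. *)
apply: (heis_submodule_full alpha_basis alpha_orthonormal S0 SZ) => i n v Sv.
by rewrite -(W_state (tnth alpha i) n v); exact: Sop.
Qed.
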